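(* Let $\mathbb{T}$ be a time scale with $\sup\mathbb{T}=+\infty$ and $\bar\mu_\mathbb{T}<+\infty$, and let $A=(a_{ij})\in\mathbb{R}^{n\times n}$, $b=(b_1,\dots,b_n)^T\in\mathbb{R}^n$ be such that the single-input system $x^\Delta=Ax+bu$ on $\mathbb{T}$ is positive. Let $k=\operatorname{rank}[b,Ab,\dots,A^{n-1}b]$, let $a_1,\dots,a_k\in\mathbb{R}$ satisfy $A^kb=-a_1b-a_2Ab-\dots-a_kA^{k-1}b$, and for $i=0,\dots,k-1$ set $v_{k-i}:=A^ib+a_kA^{i-1}b+\dots+a_{k-i+1}b$ (so $v_k=b$). For $j=1,\dots,n$ let $\alpha_j$ be the maximum of the numbers $-a_{ij}/b_i$ over $i\ne j$ with $b_i\neq0$, together with the number $(-a_{jj}-\gamma(\mathbb{T}))/b_j$ if $b_j\ne0$ and $\gamma(\mathbb{T})<+\infty$ (with $\alpha_j=-\infty$ if there are no such numbers). Then the system is positively stabilizable if and only if (1) for every $\lambda\in\operatorname{spec}(A)$ with $\lambda\notin\mathcal{S}_\mathbb{T}$ one has $\operatorname{rank}[\lambda I-A,\ b]=n$, and (2) there exists a row vector $K=(k_1,\dots,k_n)\in\mathbb{R}^{1\times n}$ with $k_j\ge\alpha_j$ for $j=1,\dots,n$ and $Kv_i<a_i$ for $i=1,\dots,k$.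
   Context: $\mathbb{T}$ is a time scale (closed nonempty subset of $\mathbb{R}$) with graininess $\mu_\mathbb{T}(t)=\inf\{s\in\mathbb{T}:s>t\}-t$, $\bar\mu_\mathbb{T}=\sup_t\mu_\mathbb{T}(t)$, $\gamma(\mathbb{T})=1/\bar\mu_\mathbb{T}\in(0,+\infty]$ (with $1/0=+\infty$); $x^\Delta$ is the delta derivative. The control system is positive if for every $t_0\in\mathbb{T}$, every piecewise continuous control with values in $\mathbb{R}_+$ and every initial state in $\mathbb{R}^n_+$, the trajectory stays in $\mathbb{R}^n_+$. An autonomous system $x^\Delta=Mx$ is positive if trajectories from $\mathbb{R}^n_+$ stay in $\mathbb{R}^n_+$; it is uniformly exponentially stable (resp. positively uniformly exponentially stable) if there exist $K\ge1,\alpha>0$ and an open neighborhood $V$ of $0$ with $\|x(t)\|\le Ke^{-\alpha(t-t_0)}\|x_0\|$ for all $t_0\le t$ in $\mathbb{T}$ and all $x_0\in V$ (resp. $x_0\in V\cap\mathbb{R}^n_+$). The system is positively stabilizable if there is a row vector $K$ such that $x^\Delta=(A+bK)x$ is positive and positively uniformly exponentially stable. $\mathcal{S}_\mathbb{T}$ is the set of $\lambda\in\mathbb{C}$ for which $x^\Delta=\lambda x$ is uniformly exponentially stable. *)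

(* Defs.v *)
From Stdlib Require Import Reals List.
Import ListNotations.
Open Scope R_scope.

(* vectors of R^n : nat -> R (coordinates 0..n-1); matrices: nat -> nat -> R *)
Fixpoint rsum (m : nat) (f : nat -> R) : R :=
  match m with O => 0 | S p => rsum p f + f p end.

Definition mv (n : nat) (M : nat -> nat -> R) (x : nat -> R) : nat -> R :=
  fun i => rsum n (fun j => M i j * x j).

Fixpoint Apow (n : nat) (A : nat -> nat -> R) (i : nat) (b : nat -> R) : nat -> R :=
  match i with O => b | S p => mv n A (Apow n A p b) end.

Definition vnorm (n : nat) (x : nat -> R) : R := sqrt (rsum n (fun i => x i ^ 2)).

Definition nonneg_vec (n : nat) (x : nat -> R) : Prop :=
  forall i, (i < n)%nat -> 0 <= x i.

(* open subset of R^n containing ... (only the first n coordinates count) *)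
Definition open_Rn (n : nat) (V : (nat -> R) -> Prop) : Prop :=
  forall x, V x -> exists r, 0 < r /\
    forall y, vnorm n (fun i => y i - x i) < r -> V y.

Definition C := (R * R)%type.
Definition C0 : C := (0, 0).
Definition RtoC (r : R) : C := (r, 0).
Definition Cadd (z w : C) : C := (fst z + fst w, snd z + snd w).
Definition Cmul (z w : C) : C :=
  (fst z * fst w - snd z * snd w, fst z * snd w + snd z * fst w).
Definition Cnorm (z : C) : R := sqrt (fst z ^ 2 + snd z ^ 2).
Definition Csum_list {X} (l : list X) (f : X -> C) : C :=
  fold_right (fun j acc => Cadd (f j) acc) C0 l.
Definition open_C (V : C -> Prop) : Prop :=
  forall z, V z -> exists r, 0 < r /\
    forall w, Cnorm (fst w - fst z, snd w - snd z) < r -> V w.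

Definition rsum_list (l : list nat) (f : nat -> R) : R :=
  fold_right (fun j acc => f j + acc) 0 l.

Definition indep_cols_R (rows cols : nat) (M : nat -> nat -> R) (l : list nat) : Prop :=
  NoDup l /\ (forall j, In j l -> (j < cols)%nat) /\
  forall c : nat -> R,
    (forall i, (i < rows)%nat -> rsum_list l (fun j => c j * M i j) = 0) ->
    forall j, In j l -> c j = 0.

Definition rank_R (rows cols : nat) (M : nat -> nat -> R) (r : nat) : Prop :=
  (exists l, length l = r /\ indep_cols_R rows cols M l) /\
  (forall l, indep_cols_R rows cols M l -> (length l <= r)%nat).

Definition indep_cols_C (rows cols : nat) (M : nat -> nat -> C) (l : list nat) : Prop :=
  NoDup l /\ (forall j, In j l -> (j < cols)%nat) /\
  forall c : nat -> C,
    (forall i, (i < rows)%nat -> Csum_list l (fun j => Cmul (c j) (M i j)) = C0) ->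
    forall j, In j l -> c j = C0.

Definition rank_C (rows cols : nat) (M : nat -> nat -> C) (r : nat) : Prop :=
  (exists l, length l = r /\ indep_cols_C rows cols M l) /\
  (forall l, indep_cols_C rows cols M l -> (length l <= r)%nat).

Definition in_spec (n : nat) (A : nat -> nat -> R) (lam : C) : Prop :=
  exists v : nat -> C, (exists i, (i < n)%nat /\ v i <> C0) /\
    forall i, (i < n)%nat ->
      Csum_list (seq 0 n) (fun j => Cmul (RtoC (A i j)) (v j)) = Cmul lam (v i).

Definition augm (n : nat) (A : nat -> nat -> R) (b : nat -> R) (lam : C)
  : nat -> nat -> C :=
  fun i j => if Nat.ltb j n then
               (if Nat.eqb i j then Cadd lam (RtoC (- A i j)) else RtoC (- A i j))
             else RtoC (b i).

Definition closed_set (T : R -> Prop) : Prop :=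
  forall t, (forall eps, 0 < eps -> exists s, T s /\ Rabs (s - t) < eps) -> T t.
Definition is_time_scale (T : R -> Prop) : Prop := (exists t, T t) /\ closed_set T.
Definition unbounded_above (T : R -> Prop) : Prop := forall M, exists t, T t /\ M < t.

Definition is_glb (E : R -> Prop) (m : R) : Prop :=
  (forall x, E x -> m <= x) /\ (forall m', (forall x, E x -> m' <= x) -> m' <= m).

Definition forward_jump (T : R -> Prop) (t s : R) : Prop :=
  ((exists r, T r /\ t < r) /\ is_glb (fun r => T r /\ t < r) s) \/
  (~ (exists r, T r /\ t < r) /\ s = t).

Definition graininess (T : R -> Prop) (t m : R) : Prop :=
  exists s, forward_jump T t s /\ m = s - t.

Definition grain_set (T : R -> Prop) (m : R) : Prop := exists t, T t /\ graininess T t m.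

Definition right_dense (T : R -> Prop) (t : R) : Prop := forward_jump T t t.

Definition delta_deriv (T : R -> Prop) (f : R -> R) (t D : R) : Prop :=
  exists s, forward_jump T t s /\
    forall eps, 0 < eps -> exists d, 0 < d /\
      forall r, T r -> Rabs (t - r) < d ->
        Rabs (f s - f r - D * (s - r)) <= eps * Rabs (s - r).

Definition restrict (T : R -> Prop) (t0 : R) : R -> Prop := fun t => T t /\ t0 <= t.

Definition cont_on (S : R -> Prop) (f : R -> R) (t : R) : Prop :=
  forall eps, 0 < eps -> exists d, 0 < d /\
    forall s, S s -> Rabs (s - t) < d -> Rabs (f s - f t) < eps.

Definition lim_right (T : R -> Prop) (f : R -> R) (t l : R) : Prop :=
  forall eps, 0 < eps -> exists d, 0 < d /\
    forall s, T s -> t < s < t + d -> Rabs (f s - l) < eps.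
Definition lim_left (T : R -> Prop) (f : R -> R) (t l : R) : Prop :=
  forall eps, 0 < eps -> exists d, 0 < d /\
    forall s, T s -> t - d < s < t -> Rabs (f s - l) < eps.

Definition piecewise_cont (T : R -> Prop) (u : R -> R) : Prop :=
  (forall a c, exists l : list R, forall t, T t -> a <= t <= c -> ~ In t l -> cont_on T u t) /\
  (forall t, T t -> (exists l, lim_right T u t l) /\ (exists l, lim_left T u t l)).

Definition ctrl_solution (T : R -> Prop) (n : nat) (A : nat -> nat -> R) (b : nat -> R)
  (u : R -> R) (t0 : R) (x0 : nat -> R) (x : R -> nat -> R) : Prop :=
  (forall i, (i < n)%nat -> x t0 i = x0 i) /\
  (forall i, (i < n)%nat -> forall t, restrict T t0 t -> cont_on (restrict T t0) (fun s => x s i) t) /\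
  (forall t, restrict T t0 t -> (~ right_dense T t \/ cont_on T u t) ->
     forall i, (i < n)%nat ->
       delta_deriv (restrict T t0) (fun s => x s i) t (mv n A (x t) i + b i * u t)).

Definition positive_ctrl (T : R -> Prop) (n : nat) (A : nat -> nat -> R) (b : nat -> R) : Prop :=
  forall t0 (u : R -> R) x0 x, T t0 -> piecewise_cont T u -> (forall t, T t -> 0 <= u t) ->
    nonneg_vec n x0 -> ctrl_solution T n A b u t0 x0 x ->
    forall t, T t -> t0 <= t -> nonneg_vec n (x t).

Definition auto_solution (T : R -> Prop) (n : nat) (M : nat -> nat -> R)
  (t0 : R) (x0 : nat -> R) (x : R -> nat -> R) : Prop :=
  (forall i, (i < n)%nat -> x t0 i = x0 i) /\
  (forall t, restrict T t0 t -> forall i, (i < n)%nat ->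
     delta_deriv (restrict T t0) (fun s => x s i) t (mv n M (x t) i)).

Definition positive_auto (T : R -> Prop) (n : nat) (M : nat -> nat -> R) : Prop :=
  forall t0 x0 x, T t0 -> nonneg_vec n x0 -> auto_solution T n M t0 x0 x ->
    forall t, T t -> t0 <= t -> nonneg_vec n (x t).

Definition pos_UES (T : R -> Prop) (n : nat) (M : nat -> nat -> R) : Prop :=
  exists (K al : R) (V : (nat -> R) -> Prop),
    1 <= K /\ 0 < al /\ open_Rn n V /\ V (fun _ => 0) /\
    forall t0 t x0 x, T t0 -> T t -> t0 <= t -> V x0 -> nonneg_vec n x0 ->
      auto_solution T n M t0 x0 x ->
      vnorm n (x t) <= K * exp (- (al * (t - t0))) * vnorm n x0.

Definition pos_stabilizable (T : R -> Prop) (n : nat) (A : nat -> nat -> R) (b : nat -> R) : Prop :=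
  exists K : nat -> R,
    positive_auto T n (fun i j => A i j + b i * K j) /\
    pos_UES T n (fun i j => A i j + b i * K j).

Definition C_solution (T : R -> Prop) (lam : C) (t0 : R) (z0 : C) (z : R -> C) : Prop :=
  z t0 = z0 /\
  forall t, restrict T t0 t ->
    delta_deriv (restrict T t0) (fun s => fst (z s)) t (fst (Cmul lam (z t))) /\
    delta_deriv (restrict T t0) (fun s => snd (z s)) t (snd (Cmul lam (z t))).

Definition in_S (T : R -> Prop) (lam : C) : Prop :=
  exists (K al : R) (V : C -> Prop),
    1 <= K /\ 0 < al /\ open_C V /\ V C0 /\
    forall t0 t z0 z, T t0 -> T t -> t0 <= t -> V z0 -> C_solution T lam t0 z0 z ->
      Cnorm (z t) <= K * exp (- (al * (t - t0))) * Cnorm z0.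

(* extended reals below: None = -oo *)
Definition max_list (l : list R) : option R :=
  fold_right (fun x acc => match acc with None => Some x | Some y => Some (Rmax x y) end) None l.

Definition ge_ext (x : R) (a : option R) : Prop :=
  match a with None => True | Some y => y <= x end.

(* alpha_j (j in 0..n-1); mub = mu_bar, gamma = 1/mub, gamma < +oo iff mub <> 0 *)
Definition alpha (n : nat) (A : nat -> nat -> R) (b : nat -> R) (mub : R) (j : nat) : option R :=
  max_list
    (flat_map (fun i => if Nat.eq_dec i j then []
                        else if Req_dec_T (b i) 0 then [] else [(- A i j) / b i]) (seq 0 n)
     ++ (if Req_dec_T (b j) 0 then []
         else if Req_dec_T mub 0 then [] else [(- A j j - / mub) / b j])).

Definition vvec (n : nat) (A : nat -> nat -> R) (b : nat -> R) (a : nat -> R) (k m : nat)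
  : nat -> R :=
  fun r => let i := (k - m)%nat in
    Apow n A i b r + rsum i (fun l => a (k - l)%nat * Apow n A (i - 1 - l) b r).

(* Main.v *)
(** A gain [K] turns the system into [x^Delta = M x] with [M = A + b K], which is positive iff
    [M] is Metzler and [1 + mub * M j j >= 0]; these are the inequalities [K j >= alpha j].

    Every eigenvalue [lam] of a positively uniformly exponentially stable system lies in [S_T]:
    states are differences of nonnegative ones, so all solutions decay, among them [Re (z v)]
    for [M v = lam v] and [z^Delta = lam z]. Moreover [S_T] lies in the open left half-plane,
    since [|z|] does not decrease when [Re lam >= 0]. Conversely, a Metzler matrix [M] without
    real eigenvalue [lam >= 0] has a row vector [w > 0] with [w M < 0], and then [w x] decays
    exponentially along nonnegative solutions.

    Necessity: an uncontrollable eigenvalue of [A] is an eigenvalue of every closed loop, hence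
    lies in [S_T]. The numbers [a_m - K v_m] are the coefficients of a monic polynomial whose
    roots are eigenvalues of [M], because [M v_(m+1) = v_m - (a_(m+1) - K v_(m+1)) b] with
    [v_k = b] and [v_0 = 0]; its roots have negative real part, so its coefficients are positive.

    Sufficiency: let [w M = lam w] with [lam >= 0]. Pairing the same recursion with [w] shows
    that [w v_m] is a positive multiple of [w b] for every [m]; as [v_0 = 0], [w b = 0]. So
    [lam] is an uncontrollable eigenvalue of [A] outside [S_T], against (1).

    Solutions exist as series [sum_k h_k(t) M^k x0] in the monomials [h_k] of the time scale. *)

From Stdlib Require Import Reals List Lra Lia Classical.
From Coquelicot Require Import Coquelicot.
From mathcomp Require all_boot all_order all_algebra Rstruct complex polyrcf zify ring.
Require Import Defs.
Open Scope R_scope.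

(** * Finite sums *)

Lemma rsum_ext (m : nat) (f g : nat -> R) :
  (forall i, (i < m)%nat -> f i = g i) -> rsum m f = rsum m g.
Proof.
  induction m as [|m IH]; intros Hfg; simpl; [reflexivity|].
  rewrite IH by (intros; apply Hfg; lia); rewrite Hfg by lia; reflexivity.
Qed.

Lemma rsum_plus (m : nat) (f g : nat -> R) :
  rsum m (fun i => f i + g i) = rsum m f + rsum m g.
Proof. induction m as [|m IH]; simpl; [ring|rewrite IH; ring]. Qed.

Lemma rsum_scal_l (m : nat) (c : R) (f : nat -> R) :
  rsum m (fun i => c * f i) = c * rsum m f.
Proof. induction m as [|m IH]; simpl; [ring|rewrite IH; ring]. Qed.

Lemma rsum_zero (m : nat) (f : nat -> R) :
  (forall i, (i < m)%nat -> f i = 0) -> rsum m f = 0.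
Proof.
  intros Hf; rewrite (rsum_ext m f (fun i => 0 * 0)) by (intros; rewrite Hf; trivial; ring).
  rewrite rsum_scal_l; ring.
Qed.

Lemma rsum_le (m : nat) (f g : nat -> R) :
  (forall i, (i < m)%nat -> f i <= g i) -> rsum m f <= rsum m g.
Proof.
  induction m as [|m IH]; intros Hfg; simpl; [lra|].
  apply Rplus_le_compat; [apply IH; intros; apply Hfg; lia|apply Hfg; lia].
Qed.

Lemma rsum_ge0 (m : nat) (f : nat -> R) :
  (forall i, (i < m)%nat -> 0 <= f i) -> 0 <= rsum m f.
Proof. intros Hf; rewrite <- (rsum_zero m (fun _ => 0)) by trivial; now apply rsum_le. Qed.

Lemma rsum_abs (m : nat) (f : nat -> R) : Rabs (rsum m f) <= rsum m (fun i => Rabs (f i)).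
Proof.
  induction m as [|m IH]; simpl; [rewrite Rabs_R0; lra|].
  apply Rle_trans with (1 := Rabs_triang _ _); lra.
Qed.

Lemma rsum_ge_term (m : nat) (f : nat -> R) (i : nat) :
  (forall j, (j < m)%nat -> j <> i -> 0 <= f j) -> (i < m)%nat -> f i <= rsum m f.
Proof.
  induction m as [|m IH]; intros Hf Hi; [lia|]; simpl.
  destruct (Nat.eq_dec i m) as [->|Him].
  - assert (0 <= rsum m f) by (apply rsum_ge0; intros; apply Hf; lia); lra.
  - assert (0 <= f m) by (apply Hf; lia).
    assert (f i <= rsum m f) by (apply IH; [intros; apply Hf; lia|lia]); lra.
Qed.

Lemma rsum_ge_abs (m : nat) (f : nat -> R) (i : nat) :
  (i < m)%nat -> Rabs (f i) <= rsum m (fun j => Rabs (f j)).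
Proof. apply (rsum_ge_term m (fun j => Rabs (f j))); intros; apply Rabs_pos. Qed.

Lemma rsum_exchange (m p : nat) (f : nat -> nat -> R) :
  rsum m (fun i => rsum p (fun j => f i j)) = rsum p (fun j => rsum m (fun i => f i j)).
Proof.
  induction m as [|m IH]; simpl; [rewrite rsum_zero; trivial|].
  rewrite IH, <- rsum_plus; reflexivity.
Qed.

Lemma rsum_telescope (m : nat) (f : nat -> R) :
  rsum m (fun i => f (S i) - f i) = f m - f 0%nat.
Proof. induction m as [|m IH]; simpl; [ring|rewrite IH; ring]. Qed.

Definition unit_vec (j i : nat) : R := if Nat.eq_dec i j then 1 else 0.

Lemma rsum_unit_vec (m j : nat) (f : nat -> R) :
  (j < m)%nat -> rsum m (fun i => f i * unit_vec j i) = f j.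
Proof.
  unfold unit_vec; induction m as [|m IH]; intros Hj; [lia|]; simpl.
  destruct (Nat.eq_dec m j) as [->|Hmj].
  - rewrite rsum_zero; [ring|].
    intros i Hi; destruct (Nat.eq_dec i j); [lia|ring].
  - rewrite IH by lia; ring.
Qed.

Lemma mv_ext (n : nat) (M : nat -> nat -> R) (x y : nat -> R) (i : nat) :
  (forall j, (j < n)%nat -> x j = y j) -> mv n M x i = mv n M y i.
Proof. intros Hxy; apply rsum_ext; intros j Hj; now rewrite Hxy. Qed.

Lemma mv_lin_comb (n : nat) (M : nat -> nat -> R) (c d : R) (x y : nat -> R) (i : nat) :
  mv n M (fun j => c * x j + d * y j) i = c * mv n M x i + d * mv n M y i.
Proof. unfold mv; rewrite <- !rsum_scal_l, <- rsum_plus; apply rsum_ext; intros; ring. Qed.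

Lemma abs_row_sum_bound (n : nat) (M : nat -> nat -> R) :
  exists L, 0 < L /\ forall i, (i < n)%nat -> rsum n (fun j => Rabs (M i j)) < L.
Proof.
  set (row := fun i => rsum n (fun j => Rabs (M i j))).
  assert (Hrow : forall i, 0 <= row i) by (intros; apply rsum_ge0; intros; apply Rabs_pos).
  exists (1 + rsum n row); split.
  - assert (0 <= rsum n row) by (apply rsum_ge0; auto); lra.
  - intros i Hi; assert (row i <= rsum n row) by (apply rsum_ge_term; auto); unfold row in *; lra.
Qed.

Lemma Apow_geometric_bound (n : nat) (M : nat -> nat -> R) (x0 : nat -> R) :
  exists L C, 0 < L /\ 0 <= C /\ forall k i, (i < n)%nat -> Rabs (Apow n M k x0 i) <= C * L ^ k.
Proof.
  destruct (abs_row_sum_bound n M) as [L [HL Hrow]].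
  exists L, (rsum n (fun j => Rabs (x0 j))); set (C := rsum n _).
  assert (HC : 0 <= C) by (apply rsum_ge0; intros; apply Rabs_pos).
  repeat split; [exact HL|exact HC|].
  induction k as [|k IH]; intros i Hi; simpl; [rewrite Rmult_1_r; now apply rsum_ge_abs|].
  assert (HLk : 0 <= C * L ^ k) by (apply Rmult_le_pos; [|apply pow_le]; lra).
  apply Rle_trans with (1 := rsum_abs _ _).
  apply Rle_trans with (rsum n (fun j => C * L ^ k * Rabs (M i j))).
  - apply rsum_le; intros j Hj; rewrite Rabs_mult, Rmult_comm.
    apply Rmult_le_compat_r; [apply Rabs_pos|now apply IH].
  - rewrite rsum_scal_l; replace (C * (L * L ^ k)) with (C * L ^ k * L) by ring.
    apply Rmult_le_compat_l; [exact HLk|left; now apply Hrow].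
Qed.

(** * Time scales *)

Lemma glb_exists (E : R -> Prop) (l : R) :
  (exists x, E x) -> (forall x, E x -> l <= x) -> exists m, is_glb E m.
Proof.
  intros [x Hx] Hl.
  destruct (completeness (fun m => forall y, E y -> m <= y)) as [m [Hub Hleast]].
  - exists x; intros m Hm; now apply Hm.
  - now exists l.
  - exists m; split; [|exact Hub].
    intros y Hy; apply Hleast; intros m' Hm; now apply Hm.
Qed.

Lemma lub_approx (E : R -> Prop) (m eps : R) :
  is_lub E m -> 0 < eps -> exists x, E x /\ m - eps < x <= m.
Proof.
  intros [Hub Hleast] Heps; apply NNPP; intros Hno.
  assert (m <= m - eps); [|lra].
  apply Hleast; intros x Hx; apply Rnot_lt_le; intros Hlt; apply Hno.
  exists x; split; [exact Hx|split; [exact Hlt|now apply Hub]].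
Qed.

Lemma glb_approx (E : R -> Prop) (m eps : R) :
  is_glb E m -> 0 < eps -> exists x, E x /\ m <= x < m + eps.
Proof.
  intros [Hlb Hgreatest] Heps; apply NNPP; intros Hno.
  assert (m + eps <= m); [|lra].
  apply Hgreatest; intros x Hx; apply Rnot_lt_le; intros Hlt; apply Hno.
  exists x; split; [exact Hx|split; [now apply Hlb|exact Hlt]].
Qed.

Lemma closed_set_lub (X E : R -> Prop) (m : R) :
  closed_set X -> (forall x, E x -> X x) -> is_lub E m -> X m.
Proof.
  intros Hclosed Hsub Hm; apply Hclosed; intros eps Heps.
  destruct (lub_approx E m eps Hm Heps) as [x [Hx Hdist]].
  exists x; split; [now apply Hsub|rewrite Rabs_left1; lra].
Qed.

Lemma closed_set_glb (X E : R -> Prop) (m : R) :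
  closed_set X -> (forall x, E x -> X x) -> is_glb E m -> X m.
Proof.
  intros Hclosed Hsub Hm; apply Hclosed; intros eps Heps.
  destruct (glb_approx E m eps Hm Heps) as [x [Hx Hdist]].
  exists x; split; [now apply Hsub|rewrite Rabs_pos_eq; lra].
Qed.

Lemma forward_jump_exists (X : R -> Prop) (t : R) : exists s, forward_jump X t s.
Proof.
  destruct (classic (exists r, X r /\ t < r)) as [Hlater|Hlast]; [|exists t; now right].
  destruct (glb_exists (fun r => X r /\ t < r) t Hlater) as [s Hs]; [intros; lra|].
  exists s; now left.
Qed.

Lemma forward_jump_unique (X : R -> Prop) (t s s' : R) :
  forward_jump X t s -> forward_jump X t s' -> s = s'.
Proof.
  intros [[Hlater [Hlb Hgreatest]]|[Hlast ->]] [[Hlater' [Hlb' Hgreatest']]|[Hlast' ->]];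
    trivial; try contradiction.
  apply Rle_antisym; auto.
Qed.

Lemma forward_jump_ge (X : R -> Prop) (t s : R) : forward_jump X t s -> t <= s.
Proof.
  intros [[_ [_ Hgreatest]]|[_ ->]]; [|lra].
  apply Hgreatest; intros x [_ Hx]; lra.
Qed.

Lemma forward_jump_le (X : R -> Prop) (t s r : R) :
  forward_jump X t s -> X r -> t < r -> s <= r.
Proof.
  intros [[_ [Hlb _]]|[Hlast _]] Hr Htr; [apply Hlb; now split|].
  exfalso; apply Hlast; now exists r.
Qed.

Lemma forward_jump_in (X : R -> Prop) (t s : R) :
  closed_set X -> X t -> forward_jump X t s -> X s.
Proof.
  intros Hclosed Ht [[_ Hglb]|[_ ->]]; [|exact Ht].
  now apply (closed_set_glb X (fun r => X r /\ t < r)).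
Qed.

Lemma right_dense_approx (X : R -> Prop) (t r d : R) :
  right_dense X t -> X r -> t < r -> 0 < d -> exists s, X s /\ t < s < t + d.
Proof.
  intros [[_ Hglb]|[Hlast _]] Hr Htr Hd; [|exfalso; apply Hlast; now exists r].
  destruct (glb_approx _ t d Hglb Hd) as [s [[Hs Hts] Hdist]]; exists s; split; [exact Hs|lra].
Qed.

Definition left_dense (X : R -> Prop) (t : R) : Prop :=
  forall eps, 0 < eps -> exists s, X s /\ t - eps < s < t.

Definition closed_from (X : R -> Prop) (t0 : R) : Prop :=
  closed_set X /\ X t0 /\ forall t, X t -> t0 <= t.

Lemma left_dense_or_jump (X : R -> Prop) (t0 t : R) :
  closed_from X t0 -> X t -> t0 < t ->
  left_dense X t \/ exists p, X p /\ p < t /\ forward_jump X p t.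
Proof.
  intros [Hclosed [Hstart _]] Ht Hlt.
  destruct (classic (left_dense X t)) as [Hld|Hnld]; [now left|right].
  set (E := fun s => X s /\ s < t).
  destruct (completeness E) as [p Hp]; [exists t; intros s [_ Hs]; lra|now exists t0|].
  assert (Hpt : p < t).
  { assert (p <= t) by (apply Hp; intros s [_ Hs]; lra).
    destruct (Req_dec p t) as [->|Hne]; [|lra].
    exfalso; apply Hnld; intros eps Heps.
    destruct (lub_approx E t eps Hp Heps) as [s [[Hs Hst] Hdist]].
    exists s; split; [exact Hs|lra]. }
  exists p; split; [apply (closed_set_lub X E); trivial; intros s [Hs _]; exact Hs|].
  split; [exact Hpt|left; split; [now exists t|split]].
  - intros r [Hr Hpr]; apply Rnot_lt_le; intros Hrt.
    assert (r <= p) by (apply Hp; now split); lra.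
  - intros m Hm; apply Hm; now split.
Qed.

Lemma ts_induction (X : R -> Prop) (t0 : R) (P : R -> Prop) :
  closed_from X t0 -> P t0 ->
  (forall t s, X t -> P t -> forward_jump X t s -> t < s -> P s) ->
  (forall t, X t -> P t -> right_dense X t ->
     exists d, 0 < d /\ forall s, X s -> t < s < t + d -> P s) ->
  (forall t, X t -> left_dense X t -> (forall s, X s -> s < t -> P s) -> P t) ->
  forall t, X t -> P t.
Proof.
  intros HX HP0 Hjump Hdense Hleft t Ht; apply NNPP; intros HnP.
  pose proof HX as [Hclosed [Hstart Hmin]].
  set (E := fun t => X t /\ ~ P t).
  destruct (glb_exists E t0) as [m Hm]; [now exists t|now intros s [Hs _]; apply Hmin|].
  assert (Hleast : forall s, X s -> ~ P s -> m <= s) by (intros; apply Hm; now split).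
  assert (HXm : X m) by (apply (closed_set_glb X E); trivial; now intros s [Hs _]).
  assert (Hbelow : forall s, X s -> s < m -> P s).
  { intros s Hs Hsm; apply NNPP; intros Hns; specialize (Hleast s Hs Hns); lra. }
  assert (HPm : P m).
  { destruct (Req_dec m t0) as [->|Hne]; [exact HP0|].
    specialize (Hmin m HXm).
    destruct (left_dense_or_jump X t0 m HX HXm) as [Hld|[p [Hp [Hpm Hj]]]]; [lra|now apply Hleft|].
    apply (Hjump p m); auto. }
  assert (Hgap : exists m', m < m' /\ forall s, X s -> m < s < m' -> P s).
  { destruct (forward_jump_exists X m) as [s Hs].
    destruct (Rle_lt_or_eq_dec m s (forward_jump_ge X m s Hs)) as [Hlt|Heq].
    - exists s; split; [exact Hlt|]; intros r Hr [Hmr Hrs].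
      pose proof (forward_jump_le X m s r Hs Hr Hmr); lra.
    - subst s; destruct (Hdense m HXm HPm Hs) as [d [Hd HPd]].
      exists (m + d); split; [lra|exact HPd]. }
  destruct Hgap as [m' [Hlt HPgap]].
  destruct (glb_approx E m (m' - m) Hm) as [s [[Hs Hns] Hdist]]; [lra|].
  apply Hns; destruct (Req_dec s m) as [->|Hne]; [exact HPm|apply HPgap; trivial; lra].
Qed.

Lemma restrict_closed_from (T : R -> Prop) (t0 : R) :
  closed_set T -> T t0 -> closed_from (restrict T t0) t0.
Proof.
  intros Hclosed Hstart; split; [|split; [split; [exact Hstart|lra]|now intros t [_ Ht]]].
  intros t Ht; split.
  - apply Hclosed; intros eps Heps; destruct (Ht eps Heps) as [s [[Hs _] Hd]]; now exists s.
  - apply Rnot_lt_le; intros Hlt; destruct (Ht (t0 - t)) as [s [[_ Hs] Hd]]; [lra|].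
    apply Rabs_def2 in Hd; lra.
Qed.

Lemma restrict_start (T : R -> Prop) (t0 : R) : T t0 -> restrict T t0 t0.
Proof. intros Hstart; split; [exact Hstart|lra]. Qed.

Lemma restrict_unbounded (T : R -> Prop) (t0 t : R) :
  unbounded_above T -> exists r, restrict T t0 r /\ t < r.
Proof.
  intros Hunb; destruct (Hunb (Rmax t t0)) as [r [Hr Hlt]]; exists r.
  pose proof (Rmax_l t t0); pose proof (Rmax_r t t0).
  repeat split; trivial; lra.
Qed.

Lemma forward_jump_restrict (T : R -> Prop) (t0 t s : R) :
  t0 <= t -> forward_jump (restrict T t0) t s <-> forward_jump T t s.
Proof.
  intros Ht.
  assert (Hiff : forall r, restrict T t0 r /\ t < r <-> T r /\ t < r).
  { intros r; unfold restrict; split; [tauto|]; intros [Hr Htr]; repeat split; trivial; lra. }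
  split; (intros [[[r Hr] [Hlb Hgreatest]]|[Hlast ->]];
    [left; split; [exists r; now apply Hiff|split;
      [intros x Hx; apply Hlb; now apply Hiff
      |intros m Hm; apply Hgreatest; intros x Hx; apply Hm; now apply Hiff]]
    |right; split; trivial; intros [r Hr]; apply Hlast; exists r; now apply Hiff]).
Qed.

Lemma grain_set_restrict (T : R -> Prop) (t0 t s : R) :
  restrict T t0 t -> forward_jump (restrict T t0) t s -> grain_set T (s - t).
Proof.
  intros [Ht Hle] Hs; exists t; split; [exact Ht|].
  exists s; split; trivial; now apply (forward_jump_restrict T t0 t s).
Qed.

Lemma grain_set_inhabited (T : R -> Prop) : is_time_scale T -> exists m, grain_set T m.
Proof.
  intros [[t Ht] _]; destruct (forward_jump_exists T t) as [s Hs].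
  exists (s - t), t; split; trivial; now exists s.
Qed.

Lemma grain_set_ge0 (T : R -> Prop) (m : R) : grain_set T m -> 0 <= m.
Proof. intros [t [_ [s [Hs ->]]]]; apply forward_jump_ge in Hs; lra. Qed.

Lemma grain_lub_ge0 (T : R -> Prop) (mub : R) :
  is_time_scale T -> is_lub (grain_set T) mub -> 0 <= mub.
Proof.
  intros HT [Hub _]; destruct (grain_set_inhabited T HT) as [m Hm].
  apply Rle_trans with m; [now apply (grain_set_ge0 T)|now apply Hub].
Qed.

Lemma grain_set_affine_ge0 (T : R -> Prop) (mub c : R) :
  is_time_scale T -> is_lub (grain_set T) mub ->
  (forall m, grain_set T m -> 0 <= 1 + m * c) <-> 0 <= 1 + mub * c.
Proof.
  intros HT Hlub; pose proof (grain_lub_ge0 T mub HT Hlub) as Hmub.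
  destruct (Rle_lt_dec 0 c) as [Hc|Hc].
  - split; [intros _; nra|intros _ m Hm; apply grain_set_ge0 in Hm; nra].
  - assert (Hinv : forall m, 0 <= 1 + m * c <-> m <= / - c).
    { intros m; assert (Hone : / - c * - c = 1) by (field; lra).
      split; intros Hm; [apply Rmult_le_reg_r with (- c)|]; nra. }
    rewrite Hinv; split.
    + intros Hall; apply Hlub; intros m Hm; now apply Hinv, Hall.
    + intros Hle m Hm; apply Hinv, Rle_trans with mub; [now apply Hlub|exact Hle].
Qed.

(** * Existence of solutions *)

Definition grid (a h x : R) : R := a + h * IZR (Int_part ((x - a) / h)).

Lemma grid_bounds (a h x : R) : 0 < h -> grid a h x <= x < grid a h x + h.
Proof.
  intros Hh; unfold grid; destruct (base_Int_part ((x - a) / h)) as [Hle Hgt].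
  assert (Hx : x = a + h * ((x - a) / h)) by (field; lra).
  split; nra.
Qed.

Lemma grid_cell (a h x : R) (i : nat) :
  0 < h -> a + INR i * h < x < a + INR i * h + h -> grid a h x = a + INR i * h.
Proof.
  intros Hh Hx; unfold grid; rewrite (Rmult_comm (INR i)); do 2 f_equal.
  rewrite INR_IZR_INZ in *; f_equal; symmetry; apply Int_part_spec.
  assert (Hxa : (x - a) / h * h = x - a) by (field; lra).
  split; [apply Rmult_lt_reg_r with h|apply Rmult_le_reg_r with h]; lra.
Qed.

Lemma IsStepFun_const_open (f : R -> R) (a b v : R) :
  a <= b -> (forall x, a < x < b -> f x = v) -> IsStepFun f a b.
Proof.
  intros Hab Hf; exists (a :: b :: nil), (v :: nil); repeat split; simpl.
  - intros [|i] Hi; simpl in *; [exact Hab|lia].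
  - now rewrite Rmin_left.
  - now rewrite Rmax_right.
  - intros [|i] Hi x Hx; simpl in *; [now apply Hf|lia].
Qed.

Lemma RiemannInt_SF_const_open (a b v : R) (f : StepFun a b) :
  a <= b -> (forall x, a < x < b -> f x = v) -> RiemannInt_SF f = v * (b - a).
Proof.
  intros Hab Hf; rewrite <- (StepFun_P18 a b v).
  apply Rle_antisym; apply StepFun_P37; trivial; intros x Hx; simpl; unfold fct_cte;
    rewrite Hf by trivial; lra.
Qed.

Lemma grid_step_integral (g : R -> R) (a h : R) (N : nat) :
  0 < h ->
  { step : IsStepFun (fun x => g (grid a h x)) a (a + INR N * h)
  | RiemannInt_SF (mkStepFun step) = h * rsum N (fun i => g (a + INR i * h)) }.
Proof.
  intros Hh; induction N as [|N [step IH]].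
  - assert (Hcell : IsStepFun (fun x => g (grid a h x)) a (a + INR 0 * h)).
    { apply (IsStepFun_const_open _ _ _ 0); simpl; intros; lra. }
    exists Hcell; rewrite (RiemannInt_SF_const_open _ _ 0); simpl; intros; lra.
  - set (c := a + INR N * h) in *.
    replace (a + INR (S N) * h) with (c + h) by (unfold c; rewrite S_INR; ring).
    assert (Hg : forall x, c < x < c + h -> g (grid a h x) = g c).
    { intros x Hx; f_equal; now apply grid_cell. }
    assert (Hcell : IsStepFun (fun x => g (grid a h x)) c (c + h))
      by (apply (IsStepFun_const_open _ _ _ (g c)); [lra|exact Hg]).
    exists (StepFun_P46 step Hcell).
    rewrite <- (StepFun_P43 step Hcell), IH, (RiemannInt_SF_const_open _ _ (g c)); trivial; [|lra].
    simpl; fold c; ring.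
Qed.

Lemma nondecreasing_Riemann_integrable (f : R -> R) (a b : R) :
  a < b -> (forall x y, x <= y -> f x <= f y) -> Riemann_integrable f a b.
Proof.
  intros Hab Hf eps.
  pose proof (cond_pos eps) as Heps; pose proof (Hf a b (Rlt_le _ _ Hab)) as Hfab.
  assert (Hvar : 0 <= (b - a) * (f b - f a) / eps).
  { apply Rmult_le_pos; [nra|left; now apply Rinv_0_lt_compat]. }
  destruct (nfloor_ex _ Hvar) as [N [_ HN]].
  rewrite <- S_INR in HN; assert (HN0 : 0 < INR (S N)) by (apply lt_0_INR; lia).
  set (h := (b - a) / INR (S N)).
  assert (Hh : 0 < h) by (apply Rdiv_lt_0_compat; lra).
  assert (Hb : a + INR (S N) * h = b) by (unfold h; field; lra).
  pose proof (fun g => grid_step_integral g a h (S N) Hh) as Hstep; rewrite Hb in Hstep.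
  destruct (Hstep f) as [lower _].
  destruct (Hstep (fun x => f (x + h) - f x)) as [gap Hgap].
  exists (mkStepFun lower), (mkStepFun gap); split.
  - intros t _; simpl; pose proof (grid_bounds a h t Hh).
    assert (f (grid a h t) <= f t <= f (grid a h t + h)) by (split; apply Hf; lra).
    rewrite Rabs_pos_eq; lra.
  - rewrite Hgap, (rsum_ext _ _ (fun i => f (a + INR (S i) * h) - f (a + INR i * h)))
      by (intros; do 2 f_equal; rewrite S_INR; ring).
    rewrite (rsum_telescope _ (fun i => f (a + INR i * h))), Hb; simpl INR at 1.
    rewrite Rmult_0_l, Rplus_0_r, Rabs_pos_eq by nra.
    apply Rmult_lt_reg_r with (INR (S N) / eps); [now apply Rdiv_lt_0_compat|].
    unfold h; replace (_ * _ * _) with ((b - a) * (f b - f a) / eps) by (field; lra).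
    replace (eps * _) with (INR (S N)) by (field; lra); exact HN.
Qed.

Lemma ex_RInt_nondecreasing (f : R -> R) (a b : R) :
  (forall x y, x <= y -> f x <= f y) -> ex_RInt f a b.
Proof.
  intros Hf; destruct (Rtotal_order a b) as [Hlt|[->|Hgt]].
  - now apply ex_RInt_Reals_1, nondecreasing_Riemann_integrable.
  - apply ex_RInt_point.
  - now apply ex_RInt_swap, ex_RInt_Reals_1, nondecreasing_Riemann_integrable.
Qed.

(* The last point of [X] before [tau], clamped to [t0] when [tau < t0]. *)
Definition ts_floor (X : R -> Prop) (t0 tau : R) : R :=
  Lub_Rbar (fun r => X r /\ r <= Rmax tau t0).

Lemma ts_floor_lub (X : R -> Prop) (t0 tau : R) :
  X t0 -> is_lub (fun r => X r /\ r <= Rmax tau t0) (ts_floor X t0 tau).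
Proof.
  intros Hstart; unfold ts_floor; set (E := fun r => _).
  destruct (completeness E) as [m [Hub Hleast]].
  - exists (Rmax tau t0); now intros r [_ Hr].
  - exists t0; split; [exact Hstart|apply Rmax_r].
  - rewrite (is_lub_Rbar_unique E (Finite m)); [now split|].
    split; [intros r Hr; now apply Hub|].
    intros [u| |] Hu; simpl; trivial; [now apply Hleast|].
    apply (Hu t0); split; [exact Hstart|apply Rmax_r].
Qed.

Lemma ts_floor_max (X : R -> Prop) (t0 tau r : R) :
  X t0 -> X r -> r <= tau -> r <= ts_floor X t0 tau.
Proof.
  intros Hstart Hr Hle; apply (ts_floor_lub X t0 tau Hstart); split; [exact Hr|].
  apply Rle_trans with tau; [exact Hle|apply Rmax_l].
Qed.

Lemma ts_floor_ge (X : R -> Prop) (t0 tau : R) : X t0 -> t0 <= ts_floor X t0 tau.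
Proof.
  intros Hstart; apply (ts_floor_lub X t0 tau Hstart); split; [exact Hstart|apply Rmax_r].
Qed.

Lemma ts_floor_le (X : R -> Prop) (t0 tau : R) :
  X t0 -> t0 <= tau -> ts_floor X t0 tau <= tau.
Proof.
  intros Hstart Ht; apply (ts_floor_lub X t0 tau Hstart); intros r [_ Hr].
  now rewrite Rmax_left in Hr.
Qed.

Lemma ts_floor_mono (X : R -> Prop) (t0 x y : R) :
  X t0 -> x <= y -> ts_floor X t0 x <= ts_floor X t0 y.
Proof.
  intros Hstart Hxy; apply (ts_floor_lub X t0 x Hstart); intros r [Hr Hle].
  apply (ts_floor_lub X t0 y Hstart); split; [exact Hr|].
  apply Rle_trans with (1 := Hle); apply Rle_max_compat_r, Hxy.
Qed.

Lemma ts_floor_in (X : R -> Prop) (t0 tau : R) :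
  closed_set X -> X t0 -> X (ts_floor X t0 tau).
Proof.
  intros Hclosed Hstart.
  apply (closed_set_lub X (fun r => X r /\ r <= Rmax tau t0)); trivial; [now intros r [Hr _]|].
  now apply ts_floor_lub.
Qed.

Lemma ts_floor_near (X : R -> Prop) (t0 t s : R) :
  closed_from X t0 -> X t -> forward_jump X t s ->
  exists d, 0 < d /\ forall r tau, X r -> Rabs (t - r) < d -> Rmin r s < tau < Rmax r s ->
    Rabs (ts_floor X t0 tau - t) <= Rabs (t - r).
Proof.
  intros [Hclosed [Hstart Hmin]] Ht Hs; pose proof (forward_jump_ge X t s Hs) as Hts.
  exists (if Req_dec_T s t then 1 else s - t); split; [destruct (Req_dec_T s t); lra|].
  intros r tau Hr Hrt Htau; pose proof (Hmin r Hr) as Hr0; pose proof (Hmin t Ht) as Ht0.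
  destruct (Rle_dec r t) as [Hle|Hgt].
  - rewrite Rmin_left, Rmax_right in Htau by lra.
    assert (ts_floor X t0 tau <= tau) by (apply ts_floor_le; trivial; lra).
    assert (r <= ts_floor X t0 tau) by (apply ts_floor_max; trivial; lra).
    assert (ts_floor X t0 tau <= t).
    { apply Rnot_lt_le; intros Hlt.
      pose proof (forward_jump_le X t s _ Hs (ts_floor_in X t0 tau Hclosed Hstart) Hlt); lra. }
    rewrite Rabs_left1, Rabs_pos_eq; lra.
  - assert (s <= r) by (apply (forward_jump_le X t s r); trivial; lra).
    destruct (Req_dec_T s t) as [->|Hne]; [|rewrite Rabs_left1 in Hrt; lra].
    rewrite Rmin_right, Rmax_left in Htau by lra.
    assert (ts_floor X t0 tau <= tau) by (apply ts_floor_le; trivial; lra).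
    assert (t <= ts_floor X t0 tau) by (apply ts_floor_max; trivial; lra).
    rewrite Rabs_pos_eq, Rabs_left1; lra.
Qed.

(* The [k]-fold iterated delta integral of [1]: the delta integral of [f] is the Riemann integral of
   [f] composed with [ts_floor]. *)
Fixpoint ts_monomial (X : R -> Prop) (t0 : R) (k : nat) (t : R) : R :=
  match k with
  | O => 1
  | S p => RInt (fun tau => ts_monomial X t0 p (ts_floor X t0 tau)) t0 t
  end.

Lemma ts_monomial_ge0_mono (X : R -> Prop) (t0 : R) (k : nat) (r s : R) :
  X t0 -> t0 <= r <= s ->
  0 <= ts_monomial X t0 k r <= ts_monomial X t0 k s.
Proof.
  intros Hstart; revert r s; induction k as [|k IH]; intros r s Hrs; [simpl; lra|].
  assert (Hint : forall x y, ex_RInt (fun tau => ts_monomial X t0 k (ts_floor X t0 tau)) x y).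
  { intros x y; apply ex_RInt_nondecreasing; intros u v Huv; apply IH.
    split; [now apply ts_floor_ge|now apply ts_floor_mono]. }
  assert (Hpos : forall x, 0 <= ts_monomial X t0 k (ts_floor X t0 x)).
  { intros x; apply (IH _ (ts_floor X t0 x)); split; [now apply ts_floor_ge|lra]. }
  simpl; split; [apply RInt_ge_0; auto; lra|].
  rewrite <- (RInt_Chasles _ t0 r s) by apply Hint; unfold plus; simpl.
  assert (0 <= RInt (fun tau => ts_monomial X t0 k (ts_floor X t0 tau)) r s); [|lra].
  apply RInt_ge_0; auto; lra.
Qed.

Lemma ts_monomial_ge0 (X : R -> Prop) (t0 : R) (k : nat) (t : R) :
  X t0 -> t0 <= t -> 0 <= ts_monomial X t0 k t.
Proof. intros Hstart Ht; apply (ts_monomial_ge0_mono X t0 k t t); trivial; lra. Qed.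

Lemma ts_monomial_mono (X : R -> Prop) (t0 : R) (k : nat) (r s : R) :
  X t0 -> t0 <= r <= s -> ts_monomial X t0 k r <= ts_monomial X t0 k s.
Proof. apply ts_monomial_ge0_mono. Qed.

Lemma ts_monomial_integrable (X : R -> Prop) (t0 : R) (k : nat) (r s : R) :
  X t0 -> ex_RInt (fun tau => ts_monomial X t0 k (ts_floor X t0 tau)) r s.
Proof.
  intros Hstart; apply ex_RInt_nondecreasing; intros x y Hxy; apply ts_monomial_mono; trivial.
  split; [now apply ts_floor_ge|now apply ts_floor_mono].
Qed.

Lemma RInt_dist_const (g : R -> R) (v m r s : R) :
  ex_RInt g r s -> (forall tau, Rmin r s < tau < Rmax r s -> Rabs (g tau - v) <= m) ->
  Rabs (RInt g r s - v * (s - r)) <= m * Rabs (s - r).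
Proof.
  assert (Hordered : forall r s, r <= s -> ex_RInt g r s ->
    (forall tau, r < tau < s -> Rabs (g tau - v) <= m) ->
    Rabs (RInt g r s - v * (s - r)) <= m * Rabs (s - r)).
  { clear r s; intros r s Hrs Hg Hbound.
    assert (Hupper : RInt g r s <= RInt (fun _ => v + m) r s).
    { apply RInt_le; trivial; [apply ex_RInt_const|]; intros x Hx.
      specialize (Hbound x Hx); apply Rabs_le_between in Hbound; lra. }
    assert (Hlower : RInt (fun _ => v - m) r s <= RInt g r s).
    { apply RInt_le; trivial; [apply ex_RInt_const|]; intros x Hx.
      specialize (Hbound x Hx); apply Rabs_le_between in Hbound; lra. }
    rewrite RInt_const in Hupper, Hlower; unfold scal in Hupper, Hlower; simpl in Hupper, Hlower.
    unfold mult in Hupper, Hlower; simpl in Hupper, Hlower.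
    rewrite (Rabs_pos_eq (s - r)) by lra; apply Rabs_le; lra. }
  intros Hg Hbound; destruct (Rle_dec r s) as [Hrs|Hrs].
  - apply Hordered; trivial; intros tau Ht; apply Hbound; rewrite Rmin_left, Rmax_right; lra.
  - rewrite <- opp_RInt_swap by now apply ex_RInt_swap.
    unfold opp; simpl.
    replace (- RInt g s r - v * (s - r)) with (- (RInt g s r - v * (r - s))) by ring.
    rewrite Rabs_Ropp, (Rabs_minus_sym s r).
    apply Hordered; [lra|now apply ex_RInt_swap|]; intros tau Ht; apply Hbound.
    rewrite Rmin_right, Rmax_left; lra.
Qed.

Lemma ts_monomial_increment (X : R -> Prop) (t0 : R) (k : nat) (v m r s : R) :
  X t0 ->
  (forall tau, Rmin r s < tau < Rmax r s ->
     Rabs (ts_monomial X t0 k (ts_floor X t0 tau) - v) <= m) ->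
  Rabs (ts_monomial X t0 (S k) s - ts_monomial X t0 (S k) r - v * (s - r)) <= m * Rabs (s - r).
Proof.
  intros Hstart Hbound; simpl.
  rewrite <- (RInt_Chasles _ t0 r s) by now apply ts_monomial_integrable.
  unfold plus; simpl; rewrite Rplus_minus_l.
  apply RInt_dist_const; [now apply ts_monomial_integrable|exact Hbound].
Qed.

Lemma exp_nondecreasing (x y : R) : x <= y -> exp x <= exp y.
Proof. intros [Hxy| ->]; [left; now apply exp_increasing|apply Rle_refl]. Qed.

Lemma is_RInt_exp_affine (be t0 t : R) :
  0 < be -> is_RInt (fun x => exp (be * (x - t0))) t0 t ((exp (be * (t - t0)) - 1) / be).
Proof.
  intros Hbe.
  replace ((exp (be * (t - t0)) - 1) / be) with
    (minus (exp (be * (t - t0)) / be) (exp (be * (t0 - t0)) / be)).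
  - apply (is_RInt_derive (fun x => exp (be * (x - t0)) / be)); intros x _.
    + auto_derive; trivial; unfold Rminus; field; lra.
    + apply (ex_derive_continuous (fun x => exp (be * (x - t0)))); auto_derive; trivial.
  - unfold minus, plus, opp; simpl; rewrite Rminus_diag, Rmult_0_r, exp_0; field; lra.
Qed.

Lemma ts_monomial_exp_bound (X : R -> Prop) (t0 be : R) (k : nat) (t : R) :
  X t0 -> 0 < be -> t0 <= t ->
  ts_monomial X t0 k t <= exp (be * (t - t0)) / be ^ k.
Proof.
  intros Hstart Hbe; revert t; induction k as [|k IH]; intros t Ht.
  - simpl; rewrite Rdiv_1_r; pose proof (exp_ineq1_le (be * (t - t0))); nra.
  - pose proof (Rinv_0_lt_compat _ (pow_lt be k Hbe)) as Hbk.
    pose proof (is_RInt_scal _ _ _ (/ be ^ k) _ (is_RInt_exp_affine be t0 t Hbe)) as Hint.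
    unfold scal in Hint; simpl in Hint; unfold mult in Hint; simpl in Hint.
    apply Rle_trans with (/ be ^ k * ((exp (be * (t - t0)) - 1) / be)).
    + rewrite <- (is_RInt_unique _ _ _ _ Hint).
      apply RInt_le; trivial; [now apply ts_monomial_integrable|eexists; exact Hint|].
      intros x Hx; apply Rle_trans with (1 := IH _ (ts_floor_ge X t0 x Hstart)).
      unfold Rdiv; rewrite Rmult_comm; apply Rmult_le_compat_l; [lra|].
      assert (ts_floor X t0 x <= x) by (apply ts_floor_le; trivial; lra).
      apply exp_nondecreasing; nra.
    + replace (exp (be * (t - t0)) / be ^ S k) with (/ be ^ k * (exp (be * (t - t0)) / be))
        by (simpl; field; split; [apply pow_nonzero|]; lra).
      apply Rmult_le_compat_l; [lra|].
      apply Rmult_le_compat_r; [left; now apply Rinv_0_lt_compat|lra].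
Qed.

Lemma ts_monomial_lipschitz (X : R -> Prop) (t0 be : R) (k : nat) (u r s : R) :
  X t0 -> 0 < be -> t0 <= r <= u -> t0 <= s <= u ->
  Rabs (ts_monomial X t0 k s - ts_monomial X t0 k r)
    <= be * exp (be * (u - t0)) / be ^ k * Rabs (s - r).
Proof.
  intros Hstart Hbe Hr Hs; pose proof (exp_pos (be * (u - t0))) as Hexp.
  destruct k as [|k].
  - simpl; rewrite Rminus_diag, Rabs_R0, Rdiv_1_r; apply Rmult_le_pos; [nra|apply Rabs_pos].
  - pose proof (pow_lt be k Hbe) as Hbk.
    rewrite <- (Rminus_0_r (_ - _)), <- (Rmult_0_l (s - r)).
    replace (be * exp (be * (u - t0)) / be ^ S k) with (exp (be * (u - t0)) / be ^ k)
      by (simpl; field; lra).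
    apply ts_monomial_increment; trivial; intros tau Htau.
    assert (Hu : t0 <= tau <= u).
    { revert Htau; unfold Rmin, Rmax; destruct (Rle_dec r s); lra. }
    pose proof (ts_floor_ge X t0 tau Hstart).
    assert (ts_floor X t0 tau <= tau) by (apply ts_floor_le; trivial; lra).
    rewrite Rminus_0_r, Rabs_pos_eq by now apply ts_monomial_ge0.
    apply Rle_trans with (ts_monomial X t0 k u).
    + apply ts_monomial_mono; trivial; lra.
    + apply ts_monomial_exp_bound; trivial; lra.
Qed.

(* The delta derivative of [h_(k+1)] is [h_k], uniformly in [k] up to a geometric factor, so that
   the series may be differentiated termwise. *)
Lemma ts_monomial_remainder (X : R -> Prop) (t0 be t s : R) :
  closed_from X t0 -> 0 < be -> X t -> forward_jump X t s ->
  exists d, 0 < d /\ forall r k, X r -> Rabs (t - r) < d ->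
    Rabs (ts_monomial X t0 (S k) s - ts_monomial X t0 (S k) r - ts_monomial X t0 k t * (s - r))
      <= be * exp (be * (t + 1 - t0)) / be ^ k * Rabs (t - r) * Rabs (s - r).
Proof.
  intros HX Hbe Ht Hs; pose proof HX as [Hclosed [Hstart Hmin]].
  destruct (ts_floor_near X t0 t s HX Ht Hs) as [d [Hd Hnear]].
  exists (Rmin d 1); split; [apply Rmin_pos; lra|]; intros r k Hr Hrt.
  pose proof (Rmin_l d 1); pose proof (Rmin_r d 1).
  apply ts_monomial_increment; trivial; intros tau Htau.
  specialize (Hnear r tau Hr ltac:(lra) Htau).
  pose proof (Hmin t Ht); pose proof (ts_floor_ge X t0 tau Hstart).
  eapply Rle_trans; [apply (ts_monomial_lipschitz X t0 be k (t + 1)); trivial; [lra|]|].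
  - split; trivial; apply Rabs_le_between in Hnear; lra.
  - apply Rmult_le_compat_l; trivial; left; apply Rdiv_lt_0_compat; [|now apply pow_lt].
    apply Rmult_lt_0_compat; [exact Hbe|apply exp_pos].
Qed.

Lemma series_geometric_bound (u : nat -> R) (K : R) :
  (forall k, Rabs (u k) <= K * (/ 2) ^ k) -> ex_series u /\ Rabs (Series u) <= 2 * K.
Proof.
  intros Hu.
  assert (Hgeom : is_series (fun k => K * (/ 2) ^ k) (2 * K)).
  { replace (2 * K) with (K * / (1 - / 2)) by field.
    apply (is_series_scal_l K (fun k => (/ 2) ^ k)), is_series_geom; rewrite Rabs_pos_eq; lra. }
  assert (Habs : ex_series (fun k => Rabs (u k))).
  { apply (ex_series_le (fun k => Rabs (u k)) (fun k => K * (/ 2) ^ k)); [|now exists (2 * K)].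
    intros k; unfold norm; simpl; unfold abs; simpl; rewrite Rabs_Rabsolu; apply Hu. }
  split; [now apply ex_series_Rabs|].
  apply Rle_trans with (Series (fun k => Rabs (u k))); [now apply Series_Rabs|].
  rewrite <- (is_series_unique _ _ Hgeom); apply Series_le; [|now exists (2 * K)].
  intros k; split; [apply Rabs_pos|apply Hu].
Qed.

Lemma is_series_rsum (m : nat) (f : nat -> nat -> R) :
  (forall j, (j < m)%nat -> ex_series (f j)) ->
  is_series (fun k => rsum m (fun j => f j k)) (rsum m (fun j => Series (f j))).
Proof.
  induction m as [|m IH]; intros Hf; simpl.
  - pose proof (is_series_scal_l 0 _ _ (is_series_geom 0 ltac:(rewrite Rabs_R0; lra))) as Hzero.
    rewrite Rmult_0_l in Hzero.
    apply is_series_ext with (2 := Hzero); intros; apply Rmult_0_l.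
  - apply (is_series_plus (fun k => rsum m (fun j => f j k)) (f m)).
    + apply IH; intros; apply Hf; lia.
    + apply Series_correct, Hf; lia.
Qed.

Section PowerSeriesSolution.

Variables (T : R -> Prop) (n : nat) (M : nat -> nat -> R) (t0 : R) (x0 : nat -> R) (L C : R).
Hypotheses (Hclosed : closed_set T) (Hstart : T t0) (HL : 0 < L) (HC : 0 <= C)
  (HApow : forall k i, (i < n)%nat -> Rabs (Apow n M k x0 i) <= C * L ^ k).

Let X := restrict T t0.
Let h := ts_monomial X t0.
Let HX : closed_from X t0 := restrict_closed_from T t0 Hclosed Hstart.
Let HXstart : X t0 := restrict_start T t0 Hstart.
Let HL2 : 0 < 2 * L := Rmult_lt_0_compat 2 L Rlt_0_2 HL.

Definition ts_flow (t : R) (i : nat) : R := Series (fun k => h k t * Apow n M k x0 i).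

Let half_pow (k : nat) : L ^ k / (2 * L) ^ k = (/ 2) ^ k.
Proof. rewrite Rpow_mult_distr, pow_inv; field; split; apply pow_nonzero; lra. Qed.

Lemma ts_flow_term_bound (t : R) (d i k : nat) :
  t0 <= t -> (i < n)%nat ->
  Rabs (h k t * Apow n M (k + d) x0 i) <= exp (2 * L * (t - t0)) * C * L ^ d * (/ 2) ^ k.
Proof.
  intros Ht Hi; rewrite <- half_pow, Rabs_mult, Rabs_pos_eq by now apply ts_monomial_ge0.
  apply Rle_trans with (exp (2 * L * (t - t0)) / (2 * L) ^ k * (C * L ^ (k + d))).
  - apply Rmult_le_compat; [now apply ts_monomial_ge0|apply Rabs_pos| |now apply HApow].
    now apply ts_monomial_exp_bound.
  - rewrite pow_add; right; field; apply pow_nonzero; lra.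
Qed.

Lemma ts_flow_summable (t : R) (i : nat) :
  t0 <= t -> (i < n)%nat -> ex_series (fun k => h k t * Apow n M k x0 i).
Proof.
  intros Ht Hi; apply (series_geometric_bound _ (exp (2 * L * (t - t0)) * C * L ^ 0)); intros k.
  rewrite <- (Nat.add_0_r k) at 2; now apply ts_flow_term_bound.
Qed.

Lemma ts_flow_shift_summable (t : R) (i : nat) :
  t0 <= t -> (i < n)%nat -> ex_series (fun k => h k t * Apow n M (S k) x0 i).
Proof.
  intros Ht Hi; apply (series_geometric_bound _ (exp (2 * L * (t - t0)) * C * L ^ 1)); intros k.
  rewrite <- Nat.add_1_r at 1; now apply ts_flow_term_bound.
Qed.

Lemma ts_flow_split (t : R) (i : nat) :
  t0 <= t -> (i < n)%nat ->
  ts_flow t i = x0 i + Series (fun k => h (S k) t * Apow n M (S k) x0 i).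
Proof.
  intros Ht Hi; unfold ts_flow; rewrite Series_incr_1 by now apply ts_flow_summable.
  f_equal; apply Rmult_1_l.
Qed.

Lemma ts_flow_start (i : nat) : (i < n)%nat -> ts_flow t0 i = x0 i.
Proof.
  intros Hi; rewrite ts_flow_split by (trivial; lra).
  rewrite (Series_ext _ (fun k => 0 * Apow n M (S k) x0 i)).
  - rewrite Series_scal_l; ring.
  - intros k; unfold h; simpl; now rewrite RInt_point.
Qed.

Lemma mv_ts_flow (t : R) (i : nat) :
  t0 <= t -> (i < n)%nat -> mv n M (ts_flow t) i = Series (fun k => h k t * Apow n M (S k) x0 i).
Proof.
  intros Ht Hi; unfold mv; symmetry; apply is_series_unique.
  apply (is_series_ext (fun k => rsum n (fun j => M i j * (h k t * Apow n M k x0 j)))).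
  { intros k; simpl; unfold mv; rewrite <- rsum_scal_l; apply rsum_ext; intros; ring. }
  unfold ts_flow.
  rewrite (rsum_ext n _ (fun j => Series (fun k => M i j * (h k t * Apow n M k x0 j))))
    by (intros; now rewrite Series_scal_l).
  apply (is_series_rsum n (fun j k => M i j * (h k t * Apow n M k x0 j))).
  intros j Hj; apply (ex_series_scal_l (M i j) (fun k => h k t * Apow n M k x0 j)).
  now apply ts_flow_summable.
Qed.

Lemma ts_flow_increment (t r s : R) (i : nat) :
  t0 <= t -> t0 <= r -> t0 <= s -> (i < n)%nat ->
  ts_flow s i - ts_flow r i - mv n M (ts_flow t) i * (s - r) =
  Series (fun k => (h (S k) s - h (S k) r - h k t * (s - r)) * Apow n M (S k) x0 i).
Proof.
  intros Ht Hr Hs Hi; rewrite (ts_flow_split s), (ts_flow_split r), mv_ts_flow by trivial.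
  assert (Htail : forall u, t0 <= u -> ex_series (fun k => h (S k) u * Apow n M (S k) x0 i)).
  { intros u Hu; apply (ex_series_incr_1 (fun k => h k u * Apow n M k x0 i)).
    now apply ts_flow_summable. }
  pose proof (ts_flow_shift_summable t i Ht Hi) as Hshift.
  rewrite (Series_ext (fun k => (h (S k) s - h (S k) r - h k t * (s - r)) * Apow n M (S k) x0 i)
    (fun k => (h (S k) s * Apow n M (S k) x0 i - h (S k) r * Apow n M (S k) x0 i)
              - (s - r) * (h k t * Apow n M (S k) x0 i))) by (intros; ring).
  rewrite !Series_minus, Series_scal_l; auto; [ring| |].
  - apply (ex_series_minus (fun k => h (S k) s * Apow n M (S k) x0 i)); auto.
  - now apply (ex_series_scal_l (s - r) (fun k => h k t * Apow n M (S k) x0 i)).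
Qed.

Lemma ts_flow_deriv (t : R) (i : nat) :
  X t -> (i < n)%nat -> delta_deriv X (fun s => ts_flow s i) t (mv n M (ts_flow t) i).
Proof.
  intros Ht Hi; pose proof HX as [HXclosed [_ Hmin]].
  destruct (forward_jump_exists X t) as [s Hs]; exists s; split; [exact Hs|].
  pose proof (Hmin t Ht) as Ht0.
  pose proof (Hmin s (forward_jump_in X t s HXclosed Ht Hs)) as Hs0.
  destruct (ts_monomial_remainder X t0 (2 * L) t s HX HL2 Ht Hs) as [d [Hd Hrem]].
  set (B := 2 * L * exp (2 * L * (t + 1 - t0)) * C * L).
  assert (HB : 0 <= B).
  { unfold B; repeat apply Rmult_le_pos; try lra; left; apply exp_pos. }
  intros eps Heps; exists (Rmin d (eps / (2 * B + 1))).
  split; [apply Rmin_pos; trivial; apply Rdiv_lt_0_compat; lra|]; intros r Hr Hrt.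
  apply Rmin_Rgt_l in Hrt as [Hrd Hreps].
  rewrite ts_flow_increment by auto.
  apply Rle_trans with (2 * (B * Rabs (t - r) * Rabs (s - r))).
  - apply series_geometric_bound; intros k; rewrite Rabs_mult, <- half_pow.
    pose proof (pow_lt (2 * L) k HL2) as Hk.
    eapply Rle_trans;
      [apply Rmult_le_compat;
        [apply Rabs_pos|apply Rabs_pos|apply (Hrem r k Hr Hrd)|now apply HApow]|].
    right; unfold B; simpl; field; lra.
  - replace (2 * _) with (2 * B * Rabs (t - r) * Rabs (s - r)) by ring.
    apply Rmult_le_compat_r; [apply Rabs_pos|].
    assert (Heps' : eps = (2 * B + 1) * (eps / (2 * B + 1))) by (field; lra).
    pose proof (Rabs_pos (t - r)); rewrite Heps'; nra.
Qed.

End PowerSeriesSolution.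

Theorem auto_solution_exists (T : R -> Prop) (n : nat) (M : nat -> nat -> R)
  (t0 : R) (x0 : nat -> R) :
  closed_set T -> T t0 -> exists x, auto_solution T n M t0 x0 x.
Proof.
  intros Hclosed Hstart; destruct (Apow_geometric_bound n M x0) as (L & C & HL & HC & HApow).
  exists (ts_flow T n M t0 x0); split.
  - intros i Hi; now apply (ts_flow_start T n M t0 x0 L C).
  - intros t Ht i Hi; now apply (ts_flow_deriv T n M t0 x0 L C).
Qed.

(** * Delta derivatives *)

Lemma le0_of_le_eps (x y : R) : 0 <= y -> (forall eps, 0 < eps -> x <= eps * y) -> x <= 0.
Proof.
  intros Hy Hxy; apply Rnot_lt_le; intros Hx.
  assert (Hq : 0 < x / (2 * (y + 1))) by (apply Rdiv_lt_0_compat; lra).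
  specialize (Hxy _ Hq).
  assert (Hxq : x = 2 * (x / (2 * (y + 1)) * (y + 1))) by (field; lra); nra.
Qed.

Lemma delta_deriv_jump (X : R -> Prop) (f : R -> R) (t s D : R) :
  X t -> forward_jump X t s -> delta_deriv X f t D -> f s = f t + (s - t) * D.
Proof.
  intros Ht Hs [s' [Hs' HD]]; rewrite (forward_jump_unique X t s' s Hs' Hs) in HD.
  assert (Hzero : Rabs (f s - f t - D * (s - t)) <= 0).
  { apply le0_of_le_eps with (Rabs (s - t)); [apply Rabs_pos|].
    intros eps Heps; destruct (HD eps Heps) as [d [Hd Happrox]]; apply Happrox; trivial.
    rewrite Rminus_diag, Rabs_R0; exact Hd. }
  apply Rabs_le_between in Hzero; lra.
Qed.

Lemma delta_deriv_cont (X : R -> Prop) (f : R -> R) (t D : R) :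
  X t -> delta_deriv X f t D -> cont_on X f t.
Proof.
  intros Ht HfD e He; pose proof HfD as [s [Hs HD]].
  pose proof (delta_deriv_jump X f t s D Ht Hs HfD) as Hfs.
  set (w := Rabs (s - t) + 1); set (B := Rabs D + 1).
  pose proof (Rabs_pos (s - t)); pose proof (Rabs_pos D).
  assert (Hw : 0 < w) by (unfold w; lra); assert (HB : 0 < B) by (unfold B; lra).
  destruct (HD (e / (2 * w))) as [d [Hd Happrox]]; [apply Rdiv_lt_0_compat; lra|].
  assert (Hd' : 0 < e / (2 * B)) by (apply Rdiv_lt_0_compat; lra).
  exists (Rmin 1 (Rmin d (e / (2 * B)))); split; [repeat apply Rmin_pos; lra|].
  intros r Hr Hrt; apply Rmin_Rgt_l in Hrt as [Hr_one Hrt]; apply Rmin_Rgt_l in Hrt as [Hrd HrB].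
  specialize (Happrox r Hr); rewrite Rabs_minus_sym in Happrox; specialize (Happrox Hrd).
  replace (f r - f t) with (D * (r - t) - (f s - f r - D * (s - r))) by (rewrite Hfs; ring).
  eapply Rle_lt_trans; [apply Rabs_triang|]; rewrite Rabs_Ropp, Rabs_mult.
  assert (Hsr : Rabs (s - r) <= w).
  { replace (s - r) with ((s - t) - (r - t)) by ring; unfold w.
    eapply Rle_trans; [apply Rabs_triang|]; rewrite Rabs_Ropp; lra. }
  assert (e / (2 * w) * Rabs (s - r) <= e / 2).
  { replace (e / 2) with (e / (2 * w) * w) by (field; lra).
    apply Rmult_le_compat_l; trivial; left; apply Rdiv_lt_0_compat; lra. }
  assert (Hhalf : e / 2 = B * (e / (2 * B))) by (field; lra).
  pose proof (Rabs_pos (r - t)); unfold B in *; nra.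
Qed.

Lemma delta_deriv_const (X : R -> Prop) (c t : R) : delta_deriv X (fun _ => c) t 0.
Proof.
  destruct (forward_jump_exists X t) as [s Hs]; exists s; split; trivial.
  intros eps Heps; exists 1; split; [lra|]; intros r _ _.
  replace (c - c - 0 * (s - r)) with 0 by ring; rewrite Rabs_R0.
  apply Rmult_le_pos; [lra|apply Rabs_pos].
Qed.

Lemma delta_deriv_plus (X : R -> Prop) (f g : R -> R) (t D E : R) :
  delta_deriv X f t D -> delta_deriv X g t E ->
  delta_deriv X (fun s => f s + g s) t (D + E).
Proof.
  intros [s [Hs HD]] [s' [Hs' HE]]; rewrite (forward_jump_unique X t s' s Hs' Hs) in HE.
  exists s; split; trivial; intros eps Heps.
  destruct (HD (eps / 2)) as [d [Hd Hf]]; [lra|].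
  destruct (HE (eps / 2)) as [d' [Hd' Hg]]; [lra|].
  exists (Rmin d d'); split; [now apply Rmin_pos|].
  intros r Hr Hrt; apply Rmin_Rgt_l in Hrt as [Hrd Hrd'].
  specialize (Hf r Hr Hrd); specialize (Hg r Hr Hrd').
  replace (f s + g s - (f r + g r) - (D + E) * (s - r)) with
    ((f s - f r - D * (s - r)) + (g s - g r - E * (s - r))) by ring.
  eapply Rle_trans; [apply Rabs_triang|]; lra.
Qed.

Lemma delta_deriv_mult (X : R -> Prop) (f g : R -> R) (t s D E : R) :
  X t -> forward_jump X t s -> delta_deriv X f t D -> delta_deriv X g t E ->
  delta_deriv X (fun u => f u * g u) t (D * g t + f s * E).
Proof.
  intros Ht Hs HfD HgE; pose proof (delta_deriv_cont X g t E Ht HgE) as Hcont.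
  destruct HfD as [s' [Hs' HD]]; rewrite (forward_jump_unique X t s' s Hs' Hs) in HD.
  destruct HgE as [s'' [Hs'' HE]]; rewrite (forward_jump_unique X t s'' s Hs'' Hs) in HE.
  exists s; split; [exact Hs|]; intros eps Heps.
  set (B := Rabs (g t) + 1 + Rabs (f s) + Rabs D).
  pose proof (Rabs_pos (g t)); pose proof (Rabs_pos (f s)); pose proof (Rabs_pos D).
  assert (HB : 0 < B) by (unfold B; lra).
  set (e := Rmin 1 (eps / B)).
  assert (HepsB : 0 < eps / B) by now apply Rdiv_lt_0_compat.
  assert (He : 0 < e) by (apply Rmin_pos; lra).
  destruct (HD e He) as [d [Hd Hf]]; destruct (HE e He) as [d' [Hd' Hg]].
  destruct (Hcont e He) as [d'' [Hd'' Hgt]].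
  exists (Rmin d (Rmin d' d'')); split; [repeat apply Rmin_pos; trivial|].
  intros r Hr Hrt; apply Rmin_Rgt_l in Hrt as [Hrd Hrt]; apply Rmin_Rgt_l in Hrt as [Hrd' Hrd''].
  specialize (Hf r Hr Hrd); specialize (Hg r Hr Hrd').
  rewrite Rabs_minus_sym in Hrd''; specialize (Hgt r Hr Hrd'').
  replace (f s * g s - f r * g r - (D * g t + f s * E) * (s - r)) with
    ((f s - f r - D * (s - r)) * g r
     + (f s * (g s - g r - E * (s - r)) + D * ((g r - g t) * (s - r)))) by ring.
  pose proof (Rmin_l 1 (eps / B)) as He_one; pose proof (Rmin_r 1 (eps / B)) as He_eps.
  fold e in He_one, He_eps.
  assert (Hgr : Rabs (g r) <= Rabs (g t) + 1).
  { replace (g r) with (g t + (g r - g t)) by ring; eapply Rle_trans; [apply Rabs_triang|lra]. }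
  set (u := Rabs (s - r)) in *; assert (Hu : 0 <= u) by apply Rabs_pos.
  eapply Rle_trans; [apply Rabs_triang|]; rewrite Rabs_mult.
  eapply Rle_trans; [apply Rplus_le_compat_l, Rabs_triang|]; rewrite !Rabs_mult; fold u.
  apply Rle_trans with (e * u * (Rabs (g t) + 1) + (Rabs (f s) * (e * u) + Rabs D * (e * u))).
  - repeat apply Rplus_le_compat.
    + apply Rmult_le_compat; trivial; apply Rabs_pos.
    + now apply Rmult_le_compat_l.
    + apply Rmult_le_compat_l; [apply Rabs_pos|]; apply Rmult_le_compat_r; lra.
  - replace (_ + _) with (e * u * B) by (unfold B; ring).
    assert (Heps' : eps = eps / B * B) by (field; lra).
    rewrite Heps' at 1; assert (0 <= u * B) by (apply Rmult_le_pos; lra); nra.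
Qed.

Lemma delta_deriv_scal (X : R -> Prop) (f : R -> R) (c t D : R) :
  X t -> delta_deriv X f t D -> delta_deriv X (fun s => c * f s) t (c * D).
Proof.
  intros Ht HfD; destruct (forward_jump_exists X t) as [s Hs].
  replace (c * D) with (0 * f t + c * D) by ring.
  apply (delta_deriv_mult X (fun _ => c) f t s 0 D); trivial; apply delta_deriv_const.
Qed.

Lemma delta_deriv_lin_comb (X : R -> Prop) (f g : R -> R) (c d t D E : R) :
  X t -> delta_deriv X f t D -> delta_deriv X g t E ->
  delta_deriv X (fun s => c * f s + d * g s) t (c * D + d * E).
Proof.
  intros Ht HfD HgE.
  apply (delta_deriv_plus X (fun s => c * f s) (fun s => d * g s)); now apply delta_deriv_scal.
Qed.

Lemma delta_deriv_rsum (X : R -> Prop) (m : nat) (w : nat -> R) (f : R -> nat -> R)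
  (t : R) (D : nat -> R) :
  X t -> (forall i, (i < m)%nat -> delta_deriv X (fun s => f s i) t (D i)) ->
  delta_deriv X (fun s => rsum m (fun i => w i * f s i)) t (rsum m (fun i => w i * D i)).
Proof.
  intros Ht; induction m as [|m IH]; intros HfD; simpl; [apply delta_deriv_const|].
  apply (delta_deriv_plus X (fun s => rsum m (fun i => w i * f s i)) (fun s => w m * f s m)).
  - apply IH; intros; apply HfD; lia.
  - apply (delta_deriv_scal X (fun s => f s m)), HfD; trivial; lia.
Qed.

Lemma delta_deriv_right_dense (X : R -> Prop) (f : R -> R) (t D : R) :
  right_dense X t -> is_derive f t D -> delta_deriv X f t D.
Proof.
  intros Ht HfD; exists t; split; [exact Ht|]; intros eps Heps.
  apply is_derive_Reals in HfD; destruct (HfD eps Heps) as [[d Hd] Happrox].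
  exists d; split; [exact Hd|]; intros r _ Hrt.
  destruct (Req_dec r t) as [->|Hne]; [rewrite !Rminus_diag, Rmult_0_r, Rminus_diag, Rabs_R0; lra|].
  specialize (Happrox (r - t) ltac:(lra)); rewrite Rabs_minus_sym in Hrt; specialize (Happrox Hrt).
  rewrite Rplus_minus in Happrox.
  replace (f t - f r - D * (t - r)) with ((t - r) * ((f r - f t) / (r - t) - D)) by (field; lra).
  rewrite Rabs_mult, Rmult_comm; apply Rmult_le_compat_r; [apply Rabs_pos|lra].
Qed.

Lemma delta_deriv_ge0_at_min (X : R -> Prop) (f : R -> R) (t D : R) :
  closed_set X -> X t -> (exists r, X r /\ t < r) -> f t = 0 -> (forall s, X s -> 0 <= f s) ->
  delta_deriv X f t D -> 0 <= D.
Proof.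
  intros Hclosed Ht [r [Hr Htr]] Hft Hf HfD; pose proof HfD as [s [Hs HD]].
  destruct (Rle_lt_or_eq_dec t s (forward_jump_ge X t s Hs)) as [Hlt|<-].
  - pose proof (delta_deriv_jump X f t s D Ht Hs HfD) as Hfs.
    pose proof (Hf s (forward_jump_in X t s Hclosed Ht Hs)); nra.
  - apply Rnot_lt_le; intros Hneg.
    destruct (HD (- D / 2)) as [d [Hd Happrox]]; [lra|].
    destruct (right_dense_approx X t r d Hs Hr Htr Hd) as [q [Hq Htq]].
    specialize (Happrox q Hq); rewrite Rabs_minus_sym, (Rabs_pos_eq (q - t)) in Happrox by lra.
    specialize (Happrox ltac:(lra)); pose proof (Hf q Hq).
    apply Rabs_le_between in Happrox; nra.
Qed.

Lemma auto_solution_lin_comb (T : R -> Prop) (n : nat) (M : nat -> nat -> R) (t0 c d : R)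
  (x0 y0 : nat -> R) (x y : R -> nat -> R) :
  auto_solution T n M t0 x0 x -> auto_solution T n M t0 y0 y ->
  auto_solution T n M t0 (fun i => c * x0 i + d * y0 i) (fun t i => c * x t i + d * y t i).
Proof.
  intros [Hx0 Hx] [Hy0 Hy]; split.
  - intros i Hi; now rewrite Hx0, Hy0.
  - intros t Ht i Hi; rewrite mv_lin_comb.
    apply (delta_deriv_lin_comb _ (fun s => x s i) (fun s => y s i)); auto.
Qed.

(** * Invariance of the nonnegative orthant *)

Lemma uniform_radius (m : nat) (Q : nat -> R -> Prop) :
  (forall i, (i < m)%nat -> exists d, 0 < d /\ forall u, u < d -> Q i u) ->
  exists d, 0 < d /\ forall i u, (i < m)%nat -> u < d -> Q i u.
Proof.
  induction m as [|m IH]; intros HQ; [exists 1; split; [lra|intros; lia]|].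
  destruct IH as [d [Hd HQd]]; [intros; apply HQ; lia|].
  destruct (HQ m) as [d' [Hd' HQd']]; [lia|].
  exists (Rmin d d'); split; [now apply Rmin_pos|].
  intros i u Hi Hu; apply Rmin_Rgt_l in Hu as [Hu Hu'].
  destruct (Nat.eq_dec i m) as [->|Hne]; [now apply HQd'|apply HQd; trivial; lia].
Qed.

Lemma delta_deriv_pos_right (X : R -> Prop) (f : R -> R) (t D : R) :
  right_dense X t -> delta_deriv X f t D -> 0 < D -> f t = 0 ->
  exists d, 0 < d /\ forall s, X s -> t < s < t + d -> 0 <= f s.
Proof.
  intros Hdense [t' [Ht' HD]] Hpos Hft.
  rewrite (forward_jump_unique X t t' t Ht' Hdense) in HD.
  destruct (HD D Hpos) as [d [Hd Happrox]]; exists d; split; [exact Hd|].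
  intros s Hs Hts; specialize (Happrox s Hs).
  rewrite Rabs_minus_sym, (Rabs_pos_eq (s - t)) in Happrox by lra.
  specialize (Happrox ltac:(lra)); apply Rabs_le_between in Happrox; nra.
Qed.

Lemma cont_on_pos_near (X : R -> Prop) (f : R -> R) (t : R) :
  cont_on X f t -> 0 < f t -> exists d, 0 < d /\ forall s, X s -> Rabs (s - t) < d -> 0 <= f s.
Proof.
  intros Hcont Hpos; destruct (Hcont (f t) Hpos) as [d [Hd Hnear]]; exists d; split; [exact Hd|].
  intros s Hs Hst; specialize (Hnear s Hs Hst); apply Rabs_def2 in Hnear; lra.
Qed.

Lemma cont_on_left_limit_ge0 (X : R -> Prop) (f : R -> R) (t : R) :
  left_dense X t -> cont_on X f t -> (forall s, X s -> s < t -> 0 <= f s) -> 0 <= f t.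
Proof.
  intros Hdense Hcont Hf; apply Rnot_lt_le; intros Hneg.
  destruct (Hcont (- f t)) as [d [Hd Hnear]]; [lra|].
  destruct (Hdense d Hd) as [s [Hs Hst]].
  specialize (Hnear s Hs); rewrite Rabs_left1 in Hnear by lra; specialize (Hnear ltac:(lra)).
  apply Rabs_def2 in Hnear; pose proof (Hf s Hs ltac:(lra)); lra.
Qed.

Theorem nonneg_vec_invariant (X : R -> Prop) (t0 : R) (m : nat) (y : R -> nat -> R) :
  closed_from X t0 ->
  (forall t i, X t -> (i < m)%nat -> cont_on X (fun s => y s i) t) ->
  nonneg_vec m (y t0) ->
  (forall t s, X t -> forward_jump X t s -> t < s -> nonneg_vec m (y t) -> nonneg_vec m (y s)) ->
  (forall t i, X t -> right_dense X t -> nonneg_vec m (y t) -> (i < m)%nat -> y t i = 0 ->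
     exists D, 0 < D /\ delta_deriv X (fun s => y s i) t D) ->
  forall t, X t -> nonneg_vec m (y t).
Proof.
  intros HX Hcont Hinit Hjump Hinward.
  apply (ts_induction X t0); trivial; [now intros; apply (Hjump t)| |].
  - intros t Ht Hy Hdense.
    destruct (uniform_radius m (fun i u => forall s, X s -> 0 < s - t <= u -> 0 <= y s i))
      as [d [Hd Hnear]].
    2:{ exists d; split; [exact Hd|]; intros s Hs Hts i Hi; apply (Hnear i (s - t)); trivial; lra. }
    intros i Hi; destruct (Rle_lt_or_eq_dec _ _ (Hy i Hi)) as [Hpos|Hzero].
    + destruct (cont_on_pos_near X _ t (Hcont t i Ht Hi) Hpos) as [d [Hd Hnear]].
      exists d; split; [exact Hd|]; intros u Hu s Hs Hsu; apply Hnear; trivial.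
      rewrite Rabs_pos_eq; lra.
    + destruct (Hinward t i Ht Hdense Hy Hi (eq_sym Hzero)) as [D [HD HyD]].
      destruct (delta_deriv_pos_right X _ t D Hdense HyD HD (eq_sym Hzero)) as [d [Hd Hnear]].
      exists d; split; [exact Hd|]; intros u Hu s Hs Hsu; apply Hnear; trivial; lra.
  - intros t Ht Hdense Hy i Hi; apply (cont_on_left_limit_ge0 X (fun s => y s i) t Hdense); auto.
    intros s Hs Hst; now apply Hy.
Qed.

Lemma is_derive_cont_on (X : R -> Prop) (f : R -> R) (t l : R) :
  is_derive f t l -> cont_on X f t.
Proof.
  intros Hf eps Heps.
  pose proof (ex_derive_continuous f t (ex_intro _ l Hf)) as Hcont.
  destruct (proj1 (filterlim_locally f (f t)) Hcont (mkposreal eps Heps)) as [[d Hd] Hnear].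
  exists d; split; [exact Hd|]; intros s _ Hst; exact (Hnear s Hst).
Qed.

Lemma cont_on_plus (X : R -> Prop) (f g : R -> R) (t : R) :
  cont_on X f t -> cont_on X g t -> cont_on X (fun s => f s + g s) t.
Proof.
  intros Hf Hg eps Heps.
  destruct (Hf (eps / 2)) as [d [Hd Hfd]]; [lra|].
  destruct (Hg (eps / 2)) as [d' [Hd' Hgd]]; [lra|].
  exists (Rmin d d'); split; [now apply Rmin_pos|].
  intros s Hs Hst; apply Rmin_Rgt_l in Hst as [Hsd Hsd'].
  specialize (Hfd s Hs Hsd); specialize (Hgd s Hs Hsd').
  replace (f s + g s - (f t + g t)) with ((f s - f t) + (g s - g t)) by ring.
  eapply Rle_lt_trans; [apply Rabs_triang|lra].
Qed.

Theorem barrier_invariant (X : R -> Prop) (t0 : R) (m : nat) (x : R -> nat -> R) (B B' : R -> R) :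
  closed_from X t0 ->
  (forall t, is_derive B t (B' t)) ->
  nonneg_vec m (fun i => B t0 + x t0 i) ->
  (forall t i, X t -> (i < m)%nat -> exists D, delta_deriv X (fun s => x s i) t D /\
     (nonneg_vec m (fun j => B t + x t j) ->
       (forall s, forward_jump X t s -> t < s -> 0 <= B s + (x t i + (s - t) * D)) /\
       (B t + x t i = 0 -> 0 < B' t + D))) ->
  forall t, X t -> nonneg_vec m (fun i => B t + x t i).
Proof.
  intros HX HB Hinit Hstep.
  apply (nonneg_vec_invariant X t0 m (fun t i => B t + x t i)); trivial.
  - intros t i Ht Hi; destruct (Hstep t i Ht Hi) as [D [HxD _]].
    apply (cont_on_plus X B (fun s => x s i)).
    + apply (is_derive_cont_on X B t (B' t)), HB.
    + now apply (delta_deriv_cont X (fun s => x s i) t D).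
  - intros t s Ht Hs Hts Hy i Hi; destruct (Hstep t i Ht Hi) as [D [HxD Hinv]].
    rewrite (delta_deriv_jump X (fun s => x s i) t s D Ht Hs HxD); now apply Hinv.
  - intros t i Ht Hdense Hy Hi Hzero; destruct (Hstep t i Ht Hi) as [D [HxD Hinv]].
    exists (B' t + D); split; [now apply Hinv|].
    apply (delta_deriv_plus X B (fun s => x s i)); trivial; now apply delta_deriv_right_dense.
Qed.

Lemma delta_deriv_ge0_le (X : R -> Prop) (t0 : R) (f : R -> R) (t : R) :
  closed_from X t0 -> (forall t, X t -> exists D, 0 <= D /\ delta_deriv X f t D) ->
  X t -> f t0 <= f t.
Proof.
  intros HX HfD Ht; pose proof HX as [_ [Hstart Hmin]]; specialize (Hmin t Ht).
  enough (f t0 - f t <= 0) by lra.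
  apply le0_of_le_eps with (1 + (t - t0)); [lra|]; intros eps Heps.
  assert (Hbar : nonneg_vec 1 (fun _ => eps * (1 + (t - t0)) - f t0 + f t)).
  2:{ specialize (Hbar 0%nat Nat.lt_0_1); cbv beta in Hbar; lra. }
  apply (barrier_invariant X t0 1 (fun t _ => f t)
           (fun t => eps * (1 + (t - t0)) - f t0) (fun _ => eps)); trivial.
  - intros u; auto_derive; trivial; ring.
  - intros i _; lra.
  - intros u i Hu Hi; destruct (HfD u Hu) as [D [HD Hfu]]; exists D; split; [exact Hfu|].
    intros Hy; specialize (Hy i Hi); cbv beta in Hy; split; [intros s _ Hus; nra|lra].
Qed.

Lemma delta_deriv_zero_const (X : R -> Prop) (t0 : R) (f : R -> R) (t : R) :
  closed_from X t0 -> (forall t, X t -> delta_deriv X f t 0) -> X t -> f t = f t0.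
Proof.
  intros HX Hf Ht; apply Rle_antisym.
  - enough (-1 * f t0 <= -1 * f t) by lra.
    apply (delta_deriv_ge0_le X t0 (fun t => -1 * f t)); trivial.
    intros u Hu; exists (-1 * 0); split; [lra|apply delta_deriv_scal; auto].
  - apply (delta_deriv_ge0_le X t0 f); trivial; intros u Hu; exists 0; split; [lra|auto].
Qed.

(* The barrier [e t * (f t0 + eps * (1 + (t - t0)))] has a delta derivative exceeding [- al] times
   itself, so it stays above [f]. *)
Lemma delta_deriv_exp_decay (X : R -> Prop) (t0 al : R) (f D : R -> R) (t : R) :
  closed_from X t0 -> 0 < al -> (forall t, X t -> 0 <= f t) ->
  (forall t, X t -> delta_deriv X f t (D t)) -> (forall t, X t -> D t <= - al * f t) ->
  X t -> f t <= exp (- (al * (t - t0))) * f t0.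
Proof.
  intros HX Hal Hf HfD HD Ht; pose proof HX as [_ [Hstart Hmin]]; pose proof (Hmin t Ht).
  set (e := fun t => exp (- (al * (t - t0)))).
  assert (He : forall u, 0 < e u) by (intros; apply exp_pos); fold (e t); pose proof (He t).
  enough (f t - e t * f t0 <= 0) by lra.
  apply le0_of_le_eps with (e t * (1 + (t - t0))); [nra|]; intros eps Heps.
  assert (Hbar : nonneg_vec 1 (fun _ => e t * (f t0 + eps * (1 + (t - t0))) + -1 * f t)).
  2:{ specialize (Hbar 0%nat Nat.lt_0_1); cbv beta in Hbar; lra. }
  apply (barrier_invariant X t0 1 (fun t _ => -1 * f t)
           (fun t => e t * (f t0 + eps * (1 + (t - t0))))
           (fun t => e t * eps - al * (e t * (f t0 + eps * (1 + (t - t0)))))); trivial.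
  - intros u; unfold e; auto_derive; trivial; unfold Rminus; ring.
  - intros i _; unfold e; rewrite !Rminus_diag, Rmult_0_r, Ropp_0, exp_0; lra.
  - intros u i Hu Hi; exists (-1 * D u); split; [apply delta_deriv_scal; auto|].
    intros Hy; specialize (Hy i Hi); cbv beta in Hy.
    specialize (HD u Hu); specialize (Hf u Hu); specialize (He u); split.
    + intros s _ Hus; set (q := exp (- (al * (s - u)))).
      assert (Hes : e s = e u * q) by (unfold e, q; rewrite <- exp_plus; f_equal; ring).
      assert (Hq : 0 < q) by apply exp_pos.
      pose proof (exp_ineq1_le (- (al * (s - u)))) as Hexp; fold q in Hexp.
      assert (f u + (s - u) * D u <= q * f u) by nra.
      assert (q * f u <= q * (e u * (f t0 + eps * (1 + (u - t0))))) by nra.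
      assert (0 <= q * e u * (eps * (s - u))) by (repeat apply Rmult_le_pos; lra).
      rewrite Hes; nra.
    + intros Hzero; assert (Hfu : e u * (f t0 + eps * (1 + (u - t0))) = f u) by lra; rewrite Hfu.
      assert (0 < e u * eps) by now apply Rmult_lt_0_compat. lra.
Qed.

(** * Positive systems *)

Definition metzler (n : nat) (M : nat -> nat -> R) : Prop :=
  forall i j, (i < n)%nat -> (j < n)%nat -> i <> j -> 0 <= M i j.

Lemma metzler_mv_ge_diag (n : nat) (M : nat -> nat -> R) (y : nat -> R) (i : nat) :
  metzler n M -> nonneg_vec n y -> (i < n)%nat -> M i i * y i <= mv n M y i.
Proof.
  intros HM Hy Hi; apply (rsum_ge_term n (fun j => M i j * y j)); trivial.
  intros j Hj Hne; apply Rmult_le_pos; [apply HM; auto|auto].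
Qed.

Lemma mv_ones_lt (n : nat) (M : nat -> nat -> R) :
  exists L, 0 < L /\ forall i, (i < n)%nat -> mv n M (fun _ => 1) i < L.
Proof.
  destruct (abs_row_sum_bound n M) as [L [HL Hrow]]; exists L; split; [exact HL|].
  intros i Hi; eapply Rle_lt_trans; [|now apply (Hrow i)].
  apply rsum_le; intros; rewrite Rmult_1_r; apply Rle_abs.
Qed.

Theorem metzler_positive_auto (T : R -> Prop) (n : nat) (M : nat -> nat -> R) :
  closed_set T -> metzler n M ->
  (forall j m, (j < n)%nat -> grain_set T m -> 0 <= 1 + m * M j j) ->
  positive_auto T n M.
Proof.
  intros Hclosed HM Hdiag t0 x0 x Hstart Hx0 [Hinit Hsol] t Ht Hle i Hi.
  destruct (mv_ones_lt n M) as [L [HL Hones]].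
  set (e := fun t => exp (L * (t - t0))).
  enough (- x t i <= 0) by lra.
  apply le0_of_le_eps with (e t); [left; apply exp_pos|]; intros eps Heps.
  enough (Hbar : nonneg_vec n (fun i => eps * e t + x t i))
    by (specialize (Hbar i Hi); cbv beta in Hbar; lra).
  assert (He : forall u, 0 < eps * e u)
    by (intros; apply Rmult_lt_0_compat; [exact Heps|apply exp_pos]).
  assert (Hlower : forall u i, (i < n)%nat -> nonneg_vec n (fun j => eps * e u + x u j) ->
    M i i * (eps * e u + x u i) < L * (eps * e u) + mv n M (x u) i).
  { clear i Hi; intros u i Hi Hy; pose proof (metzler_mv_ge_diag n M _ i HM Hy Hi) as Hmv.
    rewrite (mv_ext n M _ (fun j => eps * e u * 1 + 1 * x u j)), mv_lin_comb in Hmv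
      by (intros; ring).
    specialize (Hones i Hi); specialize (He u); nra. }
  apply (barrier_invariant (restrict T t0) t0 n x (fun t => eps * e t) (fun t => L * (eps * e t))).
  - now apply restrict_closed_from.
  - intros u; unfold e; auto_derive; trivial; unfold Rminus; ring.
  - intros j Hj; specialize (He t0); specialize (Hx0 j Hj); rewrite Hinit by trivial; lra.
  - intros u j Hu Hj; exists (mv n M (x u) j); split; [now apply Hsol|]; intros Hy.
    specialize (Hlower u j Hj Hy); specialize (Hy j Hj); specialize (He u); cbv beta in Hy.
    split; [intros s Hs Hus|intros Hzero; rewrite Hzero in Hlower; lra].
    pose proof (Hdiag j (s - u) Hj (grain_set_restrict T t0 u s Hu Hs)) as Hjj.
    assert (Hes : eps * e u * (1 + L * (s - u)) <= eps * e s).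
    { replace (e s) with (e u * exp (L * (s - u)))
        by (unfold e; rewrite <- exp_plus; f_equal; ring).
      rewrite <- Rmult_assoc; apply Rmult_le_compat_l; [lra|apply exp_ineq1_le]. }
    assert (0 <= (1 + (s - u) * M j j) * (eps * e u + x u j)) by now apply Rmult_le_pos.
    assert (0 <= (s - u) * (L * (eps * e u) + mv n M (x u) j - M j j * (eps * e u + x u j)))
      by (apply Rmult_le_pos; lra).
    lra.
  - now split.
Qed.

Lemma unit_vec_ge0 (n j : nat) : nonneg_vec n (unit_vec j).
Proof. intros i _; unfold unit_vec; destruct (Nat.eq_dec i j); lra. Qed.

Lemma positive_auto_unit_solution (T : R -> Prop) (n : nat) (M : nat -> nat -> R)
  (t0 : R) (j : nat) :
  closed_set T -> positive_auto T n M -> T t0 -> (j < n)%nat ->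
  exists x, (forall i, (i < n)%nat -> x t0 i = unit_vec j i) /\
    (forall t, restrict T t0 t -> nonneg_vec n (x t)) /\
    (forall i, (i < n)%nat -> delta_deriv (restrict T t0) (fun s => x s i) t0 (M i j)).
Proof.
  intros Hclosed Hpos Hstart Hj.
  destruct (auto_solution_exists T n M t0 (unit_vec j) Hclosed Hstart) as [x Hx]; exists x.
  pose proof Hx as [Hinit Hsol]; split; [exact Hinit|split].
  - intros t [Ht Hle]; apply (Hpos t0 (unit_vec j) x); trivial; apply unit_vec_ge0.
  - intros i Hi; replace (M i j) with (mv n M (x t0) i).
    + apply Hsol; trivial; now apply restrict_start.
    + rewrite (mv_ext n M (x t0) (unit_vec j) i Hinit); exact (rsum_unit_vec n j (M i) Hj).
Qed.

Lemma positive_auto_metzler (T : R -> Prop) (n : nat) (M : nat -> nat -> R) :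
  is_time_scale T -> unbounded_above T -> positive_auto T n M -> metzler n M.
Proof.
  intros [[t0 Hstart] Hclosed] Hunb Hpos i j Hi Hj Hne.
  destruct (positive_auto_unit_solution T n M t0 j Hclosed Hpos Hstart Hj)
    as (x & Hinit & Hnonneg & Hderiv).
  apply (delta_deriv_ge0_at_min (restrict T t0) (fun s => x s i) t0); auto.
  - exact (proj1 (restrict_closed_from T t0 Hclosed Hstart)).
  - now apply restrict_start.
  - now apply restrict_unbounded.
  - rewrite Hinit by trivial; unfold unit_vec; now destruct (Nat.eq_dec i j).
  - intros s Hs; now apply Hnonneg.
Qed.

Lemma positive_auto_grain (T : R -> Prop) (n : nat) (M : nat -> nat -> R) (j : nat) (m : R) :
  closed_set T -> positive_auto T n M -> (j < n)%nat -> grain_set T m -> 0 <= 1 + m * M j j.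
Proof.
  intros Hclosed Hpos Hj [t [Ht [s [Hs ->]]]].
  destruct (positive_auto_unit_solution T n M t j Hclosed Hpos Ht Hj)
    as (x & Hinit & Hnonneg & Hderiv).
  assert (Hs' : forward_jump (restrict T t) t s) by (apply forward_jump_restrict; [lra|exact Hs]).
  pose proof (delta_deriv_jump (restrict T t) (fun s => x s j) t s _
                (restrict_start T t Ht) Hs' (Hderiv j Hj)) as Hxs.
  cbv beta in Hxs; rewrite Hinit in Hxs by trivial.
  unfold unit_vec in Hxs; destruct (Nat.eq_dec j j) as [_|]; [|contradiction].
  rewrite <- Hxs; apply Hnonneg; trivial; split; [now apply (forward_jump_in T t)|].
  now apply (forward_jump_ge T).
Qed.

Theorem positive_auto_iff (T : R -> Prop) (n : nat) (M : nat -> nat -> R) (mub : R) :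
  is_time_scale T -> unbounded_above T -> is_lub (grain_set T) mub ->
  (positive_auto T n M <-> metzler n M /\ forall j, (j < n)%nat -> 0 <= 1 + mub * M j j).
Proof.
  intros HT Hunb Hlub; pose proof HT as [_ Hclosed]; split.
  - intros Hpos; split; [now apply (positive_auto_metzler T)|].
    intros j Hj; apply (proj1 (grain_set_affine_ge0 T mub (M j j) HT Hlub)).
    intros m Hm; now apply (positive_auto_grain T n).
  - intros [HM Hdiag]; apply metzler_positive_auto; trivial.
    intros j m Hj; apply (proj2 (grain_set_affine_ge0 T mub (M j j) HT Hlub)); auto.
Qed.

Lemma piecewise_cont_const (T : R -> Prop) (c : R) : piecewise_cont T (fun _ => c).
Proof.
  assert (Hdist : forall e, 0 < e -> Rabs (c - c) < e)
    by (intros; rewrite Rminus_diag, Rabs_R0; trivial).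
  split.
  - intros u v; exists nil; intros t _ _ _ e He; exists 1; split; [lra|auto].
  - intros t _; split; exists c; intros e He; exists 1; split; try lra; auto.
Qed.

(* A constant control is absorbed into the state as an extra coordinate with zero derivative. *)
Lemma ctrl_solution_const_exists (T : R -> Prop) (n : nat) (A : nat -> nat -> R) (b : nat -> R)
  (c t0 : R) (x0 : nat -> R) :
  closed_set T -> T t0 -> exists x, ctrl_solution T n A b (fun _ => c) t0 x0 x.
Proof.
  intros Hclosed Hstart.
  set (M := fun i j => if Nat.eq_dec i n then 0 else if Nat.eq_dec j n then b i else A i j).
  set (y0 := fun i => if Nat.eq_dec i n then c else x0 i).
  destruct (auto_solution_exists T (S n) M t0 y0 Hclosed Hstart) as [y [Hinit Hsol]].
  assert (Hlast : forall t, restrict T t0 t -> y t n = c).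
  { intros t Ht; rewrite (delta_deriv_zero_const (restrict T t0) t0 (fun t => y t n)); trivial.
    - rewrite Hinit by lia; unfold y0; now destruct (Nat.eq_dec n n).
    - now apply restrict_closed_from.
    - intros s Hs; replace 0 with (mv (S n) M (y s) n); [apply Hsol; trivial; lia|].
      apply rsum_zero; intros j _; unfold M; destruct (Nat.eq_dec n n); [ring|contradiction]. }
  assert (Hmv : forall t i, restrict T t0 t -> (i < n)%nat ->
    mv (S n) M (y t) i = mv n A (y t) i + b i * c).
  { intros t i Ht Hi; unfold mv; simpl; rewrite (Hlast t Ht); f_equal.
    - apply rsum_ext; intros j Hj; unfold M.
      destruct (Nat.eq_dec i n); [lia|]; destruct (Nat.eq_dec j n); [lia|reflexivity].
    - unfold M; destruct (Nat.eq_dec i n); [lia|]; destruct (Nat.eq_dec n n); [reflexivity|lia]. }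
  exists y; repeat split.
  - intros i Hi; rewrite Hinit by lia; unfold y0; destruct (Nat.eq_dec i n); [lia|reflexivity].
  - intros i Hi t Ht; apply (delta_deriv_cont _ _ t (mv (S n) M (y t) i)); trivial.
    apply Hsol; trivial; lia.
  - intros t Ht _ i Hi; rewrite <- Hmv by trivial; apply Hsol; trivial; lia.
Qed.

Lemma positive_ctrl_auto (T : R -> Prop) (n : nat) (A : nat -> nat -> R) (b : nat -> R) :
  positive_ctrl T n A b -> positive_auto T n A.
Proof.
  intros Hpos t0 x0 x Hstart Hx0 [Hinit Hsol].
  apply (Hpos t0 (fun _ => 0) x0 x); trivial.
  - apply piecewise_cont_const.
  - intros; lra.
  - repeat split; trivial.
    + intros i Hi t Ht; apply (delta_deriv_cont _ _ t (mv n A (x t) i)); auto.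
    + intros t Ht _ i Hi; rewrite Rmult_0_r, Rplus_0_r; auto.
Qed.

Lemma positive_ctrl_input_ge0 (T : R -> Prop) (n : nat) (A : nat -> nat -> R) (b : nat -> R) :
  is_time_scale T -> unbounded_above T -> positive_ctrl T n A b -> nonneg_vec n b.
Proof.
  intros [[t0 Hstart] Hclosed] Hunb Hpos i Hi.
  destruct (ctrl_solution_const_exists T n A b 1 t0 (fun _ => 0) Hclosed Hstart) as [x Hx].
  assert (Hnonneg : forall t, T t -> t0 <= t -> nonneg_vec n (x t)).
  { apply (Hpos t0 (fun _ => 1) (fun _ => 0) x); trivial.
    - apply piecewise_cont_const.
    - intros; lra.
    - intros j _; lra. }
  destruct Hx as (Hinit & _ & Hsol).
  apply (delta_deriv_ge0_at_min (restrict T t0) (fun s => x s i) t0).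
  - exact (proj1 (restrict_closed_from T t0 Hclosed Hstart)).
  - now apply restrict_start.
  - now apply restrict_unbounded.
  - now apply Hinit.
  - intros s [Hs Hle]; now apply Hnonneg.
  - replace (b i) with (mv n A (x t0) i + b i * 1).
    + apply Hsol; [now apply restrict_start|right|exact Hi].
      intros e He; exists 1; split; [lra|]; intros; rewrite Rminus_diag, Rabs_R0; trivial.
    + unfold mv; rewrite rsum_zero; [ring|]; intros j Hj; rewrite Hinit by trivial; ring.
Qed.

Definition closed_loop (A : nat -> nat -> R) (b K : nat -> R) (i j : nat) : R := A i j + b i * K j.

Lemma ge_ext_max_list (x : R) (l : list R) :
  ge_ext x (max_list l) <-> List.Forall (fun y => y <= x) l.
Proof.
  induction l as [|z l IH]; simpl; [now split|].
  rewrite Forall_cons_iff, <- IH; destruct (max_list l) as [m|]; simpl; [|tauto].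
  split; [|intros [Hz Hm]; now apply Rmax_lub].
  intros Hmax; split; eapply Rle_trans; [apply Rmax_l|exact Hmax|apply Rmax_r|exact Hmax].
Qed.

Lemma Forall_ge_ratio_iff (b c x : R) :
  0 <= b -> (b = 0 -> 0 <= c) ->
  List.Forall (fun y => y <= x) (if Req_dec_T b 0 then nil else (- c / b) :: nil) <->
  0 <= c + b * x.
Proof.
  intros Hb Hc; destruct (Req_dec_T b 0) as [Hzero|Hne].
  - rewrite Hzero, Rmult_0_l, Rplus_0_r; split; [auto|constructor].
  - rewrite Forall_cons_iff, Rle_div_l by lra.
    split; [intros [Hle _]; lra|split; [lra|constructor]].
Qed.

Lemma ge_alpha_iff (n : nat) (A : nat -> nat -> R) (b K : nat -> R) (mub : R) (j : nat) :
  0 <= mub -> nonneg_vec n b -> (j < n)%nat ->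
  (forall i, (i < n)%nat -> i <> j -> 0 <= A i j) -> 0 <= 1 + mub * A j j ->
  (ge_ext (K j) (alpha n A b mub j) <->
   (forall i, (i < n)%nat -> i <> j -> 0 <= closed_loop A b K i j) /\
   0 <= 1 + mub * closed_loop A b K j j).
Proof.
  intros Hmub Hb Hj Hoff Hdiag; unfold alpha, closed_loop.
  assert (Hscale : forall c, 0 < mub -> 0 <= 1 + mub * c <-> 0 <= c + / mub).
  { intros c Hpos; replace (1 + mub * c) with (mub * (c + / mub)) by (field; lra).
    split; [intros; apply Rmult_le_reg_l with mub|intros; apply Rmult_le_pos]; lra. }
  rewrite ge_ext_max_list, Forall_app, Forall_flat_map, Forall_forall.
  apply Morphisms_Prop.and_iff_morphism.
  - assert (Hentry : forall i, (i < n)%nat -> i <> j ->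
      List.Forall (fun y => y <= K j) (if Nat.eq_dec i j then nil else
        if Req_dec_T (b i) 0 then nil else (- A i j / b i) :: nil) <-> 0 <= A i j + b i * K j).
    { intros i Hi Hne; destruct (Nat.eq_dec i j); [contradiction|].
      apply Forall_ge_ratio_iff; auto. }
    split.
    + intros Hall i Hi Hne; apply Hentry; trivial; apply Hall, in_seq; lia.
    + intros Hall i Hi; apply in_seq in Hi.
      destruct (Nat.eq_dec i j) as [Heq|Hne] eqn:Hdec; [constructor|].
      specialize (Hentry i ltac:(lia) Hne); rewrite Hdec in Hentry.
      apply Hentry, Hall; [lia|exact Hne].
  - destruct (Req_dec_T mub 0) as [->|Hne].
    + destruct (Req_dec_T (b j) 0); split; intros; try constructor; lra.
    + rewrite Hscale in * by lra.
      replace (- A j j - / mub) with (- (A j j + / mub)) by ring.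
      replace (A j j + b j * K j + / mub) with (A j j + / mub + b j * K j) by ring.
      apply Forall_ge_ratio_iff; auto.
Qed.

Theorem ge_alpha_positive_auto (T : R -> Prop) (n : nat) (A : nat -> nat -> R) (b K : nat -> R)
  (mub : R) :
  is_time_scale T -> unbounded_above T -> is_lub (grain_set T) mub -> positive_ctrl T n A b ->
  ((forall j, (j < n)%nat -> ge_ext (K j) (alpha n A b mub j)) <->
   positive_auto T n (closed_loop A b K)).
Proof.
  intros HT Hunb Hlub Hpos; pose proof (grain_lub_ge0 T mub HT Hlub) as Hmub.
  pose proof (positive_ctrl_input_ge0 T n A b HT Hunb Hpos) as Hb.
  apply positive_ctrl_auto, (positive_auto_iff T n A mub) in Hpos as [HA Hdiag]; trivial.
  rewrite (positive_auto_iff T n _ mub) by trivial.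
  assert (Hcolumn : forall j, (j < n)%nat -> ge_ext (K j) (alpha n A b mub j) <->
    (forall i, (i < n)%nat -> i <> j -> 0 <= closed_loop A b K i j) /\
    0 <= 1 + mub * closed_loop A b K j j).
  { intros j Hj; apply ge_alpha_iff; auto; intros i Hi Hne; now apply HA. }
  split.
  - intros HK; split; [intros i j Hi Hj Hne|intros j Hj];
      destruct (proj1 (Hcolumn j Hj) (HK j Hj)) as [Hoff Hjj]; auto.
  - intros [HM HMdiag] j Hj; apply Hcolumn; trivial; split; [|auto].
    intros i Hi Hne; now apply HM.
Qed.

(** * Exponential stability *)

Lemma vnorm_ge0 (n : nat) (x : nat -> R) : 0 <= vnorm n x.
Proof. apply sqrt_pos. Qed.

Lemma vnorm_ge_abs (n : nat) (x : nat -> R) (i : nat) : (i < n)%nat -> Rabs (x i) <= vnorm n x.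
Proof.
  intros Hi; unfold vnorm; rewrite <- sqrt_Rsqr_abs; apply sqrt_le_1_alt.
  rewrite Rsqr_pow2; apply (rsum_ge_term n (fun i => x i ^ 2)); trivial; intros; apply pow2_ge_0.
Qed.

Lemma vnorm_le_rsum_abs (n : nat) (x : nat -> R) : vnorm n x <= rsum n (fun i => Rabs (x i)).
Proof.
  assert (Hsum : forall m, 0 <= rsum m (fun i => Rabs (x i)))
    by (intros; apply rsum_ge0; intros; apply Rabs_pos).
  rewrite <- (sqrt_Rsqr (rsum n (fun i => Rabs (x i)))) by apply Hsum.
  apply sqrt_le_1_alt; induction n as [|n IH]; [unfold Rsqr; simpl; lra|].
  unfold Rsqr in *; change (rsum (S n)) with (fun f => rsum n f + f n); cbv beta.
  pose proof (Hsum n); pose proof (Rabs_pos (x n)); rewrite <- (pow2_abs (x n)); nra.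
Qed.

Lemma vnorm_le_compat (n : nat) (x y : nat -> R) :
  (forall i, (i < n)%nat -> Rabs (x i) <= Rabs (y i)) -> vnorm n x <= vnorm n y.
Proof.
  intros Hxy; apply sqrt_le_1_alt, rsum_le; intros i Hi.
  rewrite <- (pow2_abs (x i)), <- (pow2_abs (y i)); apply pow_incr; split; [apply Rabs_pos|auto].
Qed.

Lemma vnorm_scal (n : nat) (c : R) (x y : nat -> R) :
  0 <= c -> (forall i, (i < n)%nat -> y i = c * x i) -> vnorm n y = c * vnorm n x.
Proof.
  intros Hc Hy; unfold vnorm; rewrite (rsum_ext n _ (fun i => c ^ 2 * x i ^ 2)).
  - rewrite rsum_scal_l, sqrt_mult_alt, sqrt_pow2; trivial; apply pow2_ge_0.
  - intros i Hi; rewrite Hy by trivial; ring.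
Qed.

(* The neighbourhood in the definition is immaterial for linear systems. *)
Lemma pos_UES_bound_nonneg (T : R -> Prop) (n : nat) (M : nat -> nat -> R) :
  pos_UES T n M -> exists K al, 0 <= K /\ 0 < al /\
    forall t0 t x0 x, T t0 -> restrict T t0 t -> nonneg_vec n x0 -> auto_solution T n M t0 x0 x ->
      vnorm n (x t) <= K * exp (- (al * (t - t0))) * vnorm n x0.
Proof.
  intros (K & al & V & HK & Hal & HV & HVzero & Hstable).
  exists K, al; repeat split; [lra|exact Hal|].
  intros t0 t x0 x Hstart [Ht Hle] Hx0 Hx.
  destruct (HV _ HVzero) as [r [Hr Hball]]; pose proof (vnorm_ge0 n x0) as Hnorm.
  set (d := r / (vnorm n x0 + 1)); assert (Hd : 0 < d) by (apply Rdiv_lt_0_compat; lra).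
  assert (Hdr : d * (vnorm n x0 + 1) = r) by (unfold d; field; lra).
  pose proof (auto_solution_lin_comb T n M t0 d 0 x0 x0 x x Hx Hx) as Hdx.
  apply Rmult_le_reg_l with d; [exact Hd|].
  replace (d * (K * _ * _)) with (K * exp (- (al * (t - t0))) * (d * vnorm n x0)) by ring.
  rewrite <- (vnorm_scal n d (x t) (fun i => d * x t i + 0 * x t i)) by (intros; lra).
  rewrite <- (vnorm_scal n d x0 (fun i => d * x0 i + 0 * x0 i)) by (intros; lra).
  apply (Hstable t0 t _ (fun t i => d * x t i + 0 * x t i)); trivial.
  - apply Hball; rewrite (vnorm_scal n d x0) by (intros; lra); lra.
  - intros i Hi; specialize (Hx0 i Hi); nra.
Qed.

(* Every state is a difference of nonnegative ones, [x0 = y0 - (y0 - x0)] with [y0 = max x0 0]. *)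
Lemma pos_UES_bound (T : R -> Prop) (n : nat) (M : nat -> nat -> R) :
  closed_set T -> pos_UES T n M -> exists K al, 0 <= K /\ 0 < al /\
    forall t0 t x0 x i, T t0 -> restrict T t0 t -> auto_solution T n M t0 x0 x -> (i < n)%nat ->
      Rabs (x t i) <= K * exp (- (al * (t - t0))) * vnorm n x0.
Proof.
  intros Hclosed HUES; destruct (pos_UES_bound_nonneg T n M HUES) as (K & al & HK & Hal & Hbound).
  exists (2 * K), al; repeat split; [lra|exact Hal|].
  intros t0 t x0 x i Hstart Ht Hx Hi.
  set (y0 := fun i => Rmax (x0 i) 0).
  destruct (auto_solution_exists T n M t0 y0 Hclosed Hstart) as [y Hy].
  pose proof (auto_solution_lin_comb T n M t0 1 (-1) y0 x0 y x Hy Hx) as Hz.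
  set (E := K * exp (- (al * (t - t0)))).
  assert (HE : 0 <= E) by (apply Rmult_le_pos; [exact HK|left; apply exp_pos]).
  assert (Hpart : forall z0 z, nonneg_vec n z0 -> auto_solution T n M t0 z0 z ->
    (forall j, (j < n)%nat -> Rabs (z0 j) <= Rabs (x0 j)) -> Rabs (z t i) <= E * vnorm n x0).
  { intros z0 z Hz0 Hsol Hle; eapply Rle_trans; [now apply (vnorm_ge_abs n (z t))|].
    eapply Rle_trans; [now apply (Hbound t0 t z0 z)|]; fold E.
    apply Rmult_le_compat_l; [exact HE|now apply vnorm_le_compat]. }
  assert (Hyt : Rabs (y t i) <= E * vnorm n x0).
  { apply (Hpart y0); trivial; intros j Hj; unfold y0; [apply Rmax_r|].
    unfold Rmax, Rabs; destruct (Rle_dec (x0 j) 0); repeat destruct (Rcase_abs _); lra. }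
  assert (Hzt : Rabs (1 * y t i + -1 * x t i) <= E * vnorm n x0).
  { apply (Hpart _ _) with (2 := Hz); intros j Hj; unfold y0.
    - pose proof (Rmax_l (x0 j) 0); lra.
    - unfold Rmax, Rabs; destruct (Rle_dec (x0 j) 0); repeat destruct (Rcase_abs _); lra. }
  replace (x t i) with (y t i + - (1 * y t i + -1 * x t i)) by ring.
  replace (2 * K * _ * _) with (2 * (E * vnorm n x0)) by (unfold E; ring).
  eapply Rle_trans; [apply Rabs_triang|]; rewrite Rabs_Ropp; lra.
Qed.

Definition left_certificate (n : nat) (M : nat -> nat -> R) (w : nat -> R) : Prop :=
  (forall i, (i < n)%nat -> 0 < w i) /\
  forall j, (j < n)%nat -> rsum n (fun i => w i * M i j) < 0.

Lemma finite_pos_lower_bound (n : nat) (f : nat -> R) :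
  (forall i, (i < n)%nat -> 0 < f i) -> exists m, 0 < m /\ forall i, (i < n)%nat -> m <= f i.
Proof.
  induction n as [|n IH]; intros Hf; [exists 1; split; [lra|lia]|].
  destruct IH as [m [Hm Hlow]]; [intros; apply Hf; lia|].
  exists (Rmin m (f n)); split; [apply Rmin_pos; trivial; apply Hf; lia|].
  intros i Hi; destruct (Nat.eq_dec i n) as [->|Hne]; [apply Rmin_r|].
  eapply Rle_trans; [apply Rmin_l|apply Hlow; lia].
Qed.

Lemma left_certificate_rate (n : nat) (M : nat -> nat -> R) (w : nat -> R) :
  left_certificate n M w ->
  exists al, 0 < al /\ forall j, (j < n)%nat -> rsum n (fun i => w i * M i j) <= - al * w j.
Proof.
  intros [Hw HwM].
  destruct (finite_pos_lower_bound n (fun j => - rsum n (fun i => w i * M i j) / w j))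
    as [al [Hal Hlow]].
  - intros j Hj; specialize (Hw j Hj); specialize (HwM j Hj); apply Rdiv_lt_0_compat; lra.
  - exists al; split; [exact Hal|]; intros j Hj; specialize (Hw j Hj); specialize (Hlow j Hj).
    apply Rle_div_r in Hlow; lra.
Qed.

Lemma rsum_mv (n : nat) (M : nat -> nat -> R) (w x : nat -> R) :
  rsum n (fun i => w i * mv n M x i) = rsum n (fun j => rsum n (fun i => w i * M i j) * x j).
Proof.
  unfold mv; rewrite (rsum_ext n _ (fun i => rsum n (fun j => w i * M i j * x j))).
  - rewrite rsum_exchange; apply rsum_ext; intros j Hj.
    rewrite Rmult_comm, <- rsum_scal_l; apply rsum_ext; intros; ring.
  - intros i Hi; rewrite <- rsum_scal_l; apply rsum_ext; intros; ring.
Qed.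

Lemma positive_form_decay (T : R -> Prop) (n : nat) (M : nat -> nat -> R) (w : nat -> R) (al : R)
  (t0 t : R) (x0 : nat -> R) (x : R -> nat -> R) :
  closed_set T -> positive_auto T n M -> nonneg_vec n w -> 0 < al ->
  (forall j, (j < n)%nat -> rsum n (fun i => w i * M i j) <= - al * w j) ->
  T t0 -> restrict T t0 t -> nonneg_vec n x0 -> auto_solution T n M t0 x0 x ->
  rsum n (fun i => w i * x t i) <= exp (- (al * (t - t0))) * rsum n (fun i => w i * x0 i).
Proof.
  intros Hclosed Hpos Hw Hal Hrate Hstart Ht Hx0 Hx.
  assert (Hnonneg : forall s, restrict T t0 s -> nonneg_vec n (x s)).
  { intros s [Hs Hle]; now apply (Hpos t0 x0 x). }
  destruct Hx as [Hinit Hsol].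
  rewrite (rsum_ext n (fun i => w i * x0 i) (fun i => w i * x t0 i)) by (intros; now rewrite Hinit).
  apply (delta_deriv_exp_decay (restrict T t0) t0 al (fun t => rsum n (fun i => w i * x t i))
           (fun t => rsum n (fun i => w i * mv n M (x t) i))); trivial.
  - now apply restrict_closed_from.
  - intros s Hs; apply rsum_ge0; intros i Hi; apply Rmult_le_pos; [auto|now apply Hnonneg].
  - intros s Hs; apply delta_deriv_rsum; auto.
  - intros s Hs; rewrite rsum_mv, <- rsum_scal_l; apply rsum_le; intros j Hj.
    rewrite <- Rmult_assoc; apply Rmult_le_compat_r; [now apply Hnonneg|auto].
Qed.

Lemma positive_form_vnorm (n : nat) (w : nat -> R) :
  (forall i, (i < n)%nat -> 0 < w i) -> exists m W, 0 < m /\ 0 <= W /\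
    forall x, nonneg_vec n x ->
      m * vnorm n x <= rsum n (fun i => w i * x i) <= W * vnorm n x.
Proof.
  intros Hw; destruct (finite_pos_lower_bound n w Hw) as [m [Hm Hlow]].
  exists m, (rsum n w); split; [exact Hm|split; [apply rsum_ge0; intros; left; auto|]].
  intros x Hx; split.
  - apply Rle_trans with (m * rsum n (fun i => Rabs (x i))).
    + apply Rmult_le_compat_l; [lra|apply vnorm_le_rsum_abs].
    + rewrite <- rsum_scal_l; apply rsum_le; intros i Hi; rewrite Rabs_pos_eq by auto.
      apply Rmult_le_compat_r; auto.
  - rewrite Rmult_comm, <- rsum_scal_l; apply rsum_le; intros i Hi; rewrite Rmult_comm.
    apply Rmult_le_compat_r; [left; auto|].
    eapply Rle_trans; [apply Rle_abs|now apply vnorm_ge_abs].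
Qed.

Theorem pos_UES_of_left_certificate (T : R -> Prop) (n : nat) (M : nat -> nat -> R) (w : nat -> R) :
  closed_set T -> positive_auto T n M -> left_certificate n M w -> pos_UES T n M.
Proof.
  intros Hclosed Hpos Hcert; destruct (left_certificate_rate n M w Hcert) as [al [Hal Hrate]].
  destruct Hcert as [Hw _]; destruct (positive_form_vnorm n w Hw) as (m & W & Hm & HW & Hnorm).
  exists (Rmax 1 (W / m)), al, (fun _ => True); split; [apply Rmax_l|split; [exact Hal|]].
  split; [intros z _; exists 1; split; [lra|trivial]|]; split; [trivial|].
  intros t0 t x0 x Hstart Ht Hle _ Hx0 Hx.
  set (E := exp (- (al * (t - t0)))); assert (HE : 0 < E) by apply exp_pos.
  pose proof (vnorm_ge0 n x0) as Hx0_norm.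
  assert (Hdecay : rsum n (fun i => w i * x t i) <= E * rsum n (fun i => w i * x0 i)).
  { apply (positive_form_decay T n M w al t0 t x0 x); trivial; [|now split].
    intros i Hi; left; auto. }
  destruct (Hnorm (x t)) as [Hlower _]; [now apply (Hpos t0 x0 x)|].
  destruct (Hnorm x0 Hx0) as [_ Hupper].
  apply Rle_trans with (W / m * E * vnorm n x0).
  - apply Rmult_le_reg_l with m; trivial.
    replace (m * (W / m * E * vnorm n x0)) with (E * (W * vnorm n x0)) by (field; lra).
    eapply Rle_trans; [exact Hlower|]; eapply Rle_trans; [exact Hdecay|].
    apply Rmult_le_compat_l; lra.
  - apply Rmult_le_compat_r; trivial; apply Rmult_le_compat_r; [lra|apply Rmax_r].
Qed.

(** * Eigenvalues and the stability set *)

Lemma Cnorm_ge0 (z : C) : 0 <= Cnorm z.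
Proof. apply sqrt_pos. Qed.

Lemma Cnorm_mul (z w : C) : Cnorm (Cmul z w) = Cnorm z * Cnorm w.
Proof.
  unfold Cnorm; rewrite <- sqrt_mult by (apply Rplus_le_le_0_compat; apply pow2_ge_0).
  f_equal; unfold Cmul; simpl; ring.
Qed.

Lemma Cnorm_le_abs (z : C) : Cnorm z <= Rabs (fst z) + Rabs (snd z).
Proof.
  pose proof (Rabs_pos (fst z)); pose proof (Rabs_pos (snd z)).
  unfold Cnorm; rewrite <- (sqrt_Rsqr (Rabs (fst z) + Rabs (snd z))) by lra.
  apply sqrt_le_1_alt; unfold Rsqr.
  rewrite <- (pow2_abs (fst z)), <- (pow2_abs (snd z)); nra.
Qed.

Lemma Rabs_fst_le_Cnorm (z : C) : Rabs (fst z) <= Cnorm z.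
Proof.
  rewrite <- sqrt_Rsqr_abs; apply sqrt_le_1_alt.
  rewrite Rsqr_pow2; pose proof (pow2_ge_0 (snd z)); lra.
Qed.

Lemma Rabs_snd_le_Cnorm (z : C) : Rabs (snd z) <= Cnorm z.
Proof.
  rewrite <- sqrt_Rsqr_abs; apply sqrt_le_1_alt.
  rewrite Rsqr_pow2; pose proof (pow2_ge_0 (fst z)); lra.
Qed.

Lemma Cnorm_RtoC (x : R) : Cnorm (RtoC x) = Rabs x.
Proof.
  unfold Cnorm, RtoC; simpl fst; simpl snd; rewrite <- sqrt_Rsqr_abs, Rsqr_pow2; f_equal; ring.
Qed.

Lemma Cnorm_gt0 (z : C) : z <> C0 -> 0 < Cnorm z.
Proof.
  intros Hz; pose proof (Rabs_fst_le_Cnorm z) as Hre; pose proof (Rabs_snd_le_Cnorm z) as Him.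
  destruct (Cnorm_ge0 z) as [Hpos|Hzero]; [exact Hpos|exfalso; apply Hz].
  rewrite <- Hzero in Hre, Him; apply Rabs_le_between in Hre, Him.
  destruct z; unfold C0; simpl in *; f_equal; lra.
Qed.

Definition eigenpair (n : nat) (M : nat -> nat -> R) (lam : C) (p q : nat -> R) : Prop :=
  forall i, (i < n)%nat ->
    mv n M p i = fst lam * p i - snd lam * q i /\ mv n M q i = fst lam * q i + snd lam * p i.

Lemma Csum_list_seq (n : nat) (f : nat -> C) :
  Csum_list (seq 0 n) f = (rsum n (fun i => fst (f i)), rsum n (fun i => snd (f i))).
Proof.
  assert (Hacc : forall z, fold_right (fun j acc => Cadd (f j) acc) z (seq 0 n) =
    (rsum n (fun i => fst (f i)) + fst z, rsum n (fun i => snd (f i)) + snd z)).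
  { induction n as [|n IH]; intros z; [now rewrite !Rplus_0_l, <- surjective_pairing|].
    rewrite seq_S, fold_right_app, IH; simpl; f_equal; ring. }
  unfold Csum_list; rewrite Hacc; unfold C0; simpl; f_equal; ring.
Qed.

Lemma in_spec_eigenpair (n : nat) (M : nat -> nat -> R) (lam : C) :
  in_spec n M lam -> exists p q, eigenpair n M lam p q /\ exists j, (j < n)%nat /\ (p j, q j) <> C0.
Proof.
  intros [v [[j [Hj Hvj]] Hv]]; exists (fun i => fst (v i)), (fun i => snd (v i)); split.
  - intros i Hi; specialize (Hv i Hi); rewrite Csum_list_seq in Hv.
    apply pair_equal_spec in Hv as [Hre Him]; simpl in Hre, Him.
    split; [rewrite <- Hre|rewrite <- Him]; apply rsum_ext; intros; simpl; ring.
  - exists j; split; [exact Hj|now rewrite <- surjective_pairing].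
Qed.

Lemma eigenpair_rotate (n : nat) (M : nat -> nat -> R) (lam : C) (p q : nat -> R) :
  eigenpair n M lam p q -> eigenpair n M lam q (fun i => - p i).
Proof.
  intros Hpq i Hi; destruct (Hpq i Hi) as [Hp Hq]; split; [rewrite Hq; ring|].
  rewrite (mv_ext n M _ (fun j => -1 * p j + 0 * p j)), mv_lin_comb, Hp by (intros; ring); ring.
Qed.

(* The real part of [z(t) (p + i q)]. *)
Lemma eigenpair_solution (T : R -> Prop) (n : nat) (M : nat -> nat -> R) (lam : C) (p q : nat -> R)
  (t0 : R) (z0 : C) (z : R -> C) :
  eigenpair n M lam p q -> C_solution T lam t0 z0 z ->
  auto_solution T n M t0 (fun i => fst z0 * p i + - snd z0 * q i)
    (fun t i => fst (z t) * p i + - snd (z t) * q i).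
Proof.
  intros Hpq [Hinit Hz]; split; [intros i _; now rewrite Hinit|].
  intros t Ht i Hi; destruct (Hz t Ht) as [Hre Him]; destruct (Hpq i Hi) as [Hp Hq].
  rewrite mv_lin_comb, Hp, Hq.
  destruct (delta_deriv_lin_comb _ _ _ (p i) (- q i) t _ _ Ht Hre Him) as [s [Hs Hderiv]].
  exists s; split; [exact Hs|]; intros eps Heps; destruct (Hderiv eps Heps) as [d [Hd Happrox]].
  exists d; split; [exact Hd|]; intros r Hr Hrt; specialize (Happrox r Hr Hrt).
  replace (_ - _ - _) with (p i * fst (z s) + - q i * snd (z s)
    - (p i * fst (z r) + - q i * snd (z r))
    - (p i * fst (Cmul lam (z t)) + - q i * snd (Cmul lam (z t))) * (s - r))
    by (unfold Cmul; simpl; ring).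
  exact Happrox.
Qed.

Lemma vnorm_comb_le (n : nat) (z : C) (p q : nat -> R) :
  vnorm n (fun i => fst z * p i + - snd z * q i)
    <= Cnorm z * rsum n (fun i => Rabs (p i) + Rabs (q i)).
Proof.
  eapply Rle_trans; [apply vnorm_le_rsum_abs|]; rewrite <- rsum_scal_l.
  apply rsum_le; intros i _; eapply Rle_trans; [apply Rabs_triang|].
  rewrite !Rabs_mult, Rabs_Ropp, Rmult_plus_distr_l; apply Rplus_le_compat;
    (apply Rmult_le_compat_r; [apply Rabs_pos|]).
  - apply Rabs_fst_le_Cnorm.
  - apply Rabs_snd_le_Cnorm.
Qed.

Theorem in_spec_in_S (T : R -> Prop) (n : nat) (M : nat -> nat -> R) (lam : C) :
  closed_set T -> pos_UES T n M -> in_spec n M lam -> in_S T lam.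
Proof.
  intros Hclosed HUES Hspec.
  destruct (in_spec_eigenpair n M lam Hspec) as (p & q & Hpq & j & Hj & Hne).
  destruct (pos_UES_bound T n M Hclosed HUES) as (K & al & HK & Hal & Hbound).
  set (N := Cnorm (p j, q j)); pose proof (Cnorm_gt0 _ Hne) as HN; fold N in HN.
  set (W := fun p q => rsum n (fun i => Rabs (p i) + Rabs (q i))).
  assert (Hpart : forall p q t0 t z0 z, T t0 -> restrict T t0 t -> eigenpair n M lam p q ->
    C_solution T lam t0 z0 z ->
    Rabs (fst (z t) * p j + - snd (z t) * q j) <= K * exp (- (al * (t - t0))) * (Cnorm z0 * W p q)).
  { intros p' q' t0 t z0 z Hstart Ht Hpq' Hz.
    pose proof (eigenpair_solution T n M lam p' q' t0 z0 z Hpq' Hz) as Hsol.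
    eapply Rle_trans; [apply (Hbound t0 t _ _ j Hstart Ht Hsol Hj)|].
    apply Rmult_le_compat_l; [|apply vnorm_comb_le].
    apply Rmult_le_pos; [exact HK|left; apply exp_pos]. }
  exists (Rmax 1 (K * (W p q + W q (fun i => - p i)) / N)), al, (fun _ => True).
  split; [apply Rmax_l|split; [exact Hal|]].
  split; [intros z _; exists 1; split; [lra|trivial]|split; [trivial|]].
  intros t0 t z0 z Hstart Ht Hle _ Hz; set (E := exp (- (al * (t - t0)))).
  assert (HE : 0 < E) by apply exp_pos; pose proof (Cnorm_ge0 z0).
  assert (Hre := Hpart p q t0 t z0 z Hstart (conj Ht Hle) Hpq Hz).
  assert (Him := Hpart q _ t0 t z0 z Hstart (conj Ht Hle) (eigenpair_rotate n M lam p q Hpq) Hz).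
  fold E in Hre, Him.
  apply Rle_trans with (K * (W p q + W q (fun i => - p i)) / N * E * Cnorm z0).
  - apply Rmult_le_reg_r with N; [exact HN|].
    replace (_ * N) with (Cnorm (Cmul (z t) (p j, q j))) by apply Cnorm_mul.
    eapply Rle_trans; [apply Cnorm_le_abs|]; unfold Cmul; simpl.
    replace (_ + _ * p j) with (fst (z t) * q j + - snd (z t) * - p j) by ring.
    replace (_ - _) with (fst (z t) * p j + - snd (z t) * q j) by ring.
    eapply Rle_trans; [apply Rplus_le_compat; [exact Hre|exact Him]|].
    right; field; lra.
  - apply Rmult_le_compat_r; trivial; apply Rmult_le_compat_r; [lra|apply Rmax_r].
Qed.

Lemma C_solution_exists (T : R -> Prop) (lam : C) (t0 : R) (z0 : C) :
  closed_set T -> T t0 -> exists z, C_solution T lam t0 z0 z.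
Proof.
  intros Hclosed Hstart.
  set (M := fun i j : nat => match i, j with
                             | O, O => fst lam | O, _ => - snd lam
                             | _, O => snd lam | _, _ => fst lam end).
  set (x0 := fun i : nat => match i with O => fst z0 | _ => snd z0 end).
  destruct (auto_solution_exists T 2 M t0 x0 Hclosed Hstart) as [x [Hinit Hsol]].
  exists (fun t => (x t 0%nat, x t 1%nat)); split.
  - rewrite !Hinit by lia; symmetry; apply surjective_pairing.
  - intros t Ht; unfold Cmul; simpl; split.
    + replace (_ - _) with (mv 2 M (x t) 0) by (unfold mv; simpl; ring); apply Hsol; trivial; lia.
    + replace (_ + _) with (mv 2 M (x t) 1) by (unfold mv; simpl; ring); apply Hsol; trivial; lia.
Qed.

(* [(|z|^2)^Delta = 2 Re lam |z|^2 + mu |lam z|^2]. *)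
Lemma C_solution_Cnorm_ge (T : R -> Prop) (lam : C) (t0 t : R) (z0 : C) (z : R -> C) :
  closed_set T -> T t0 -> 0 <= fst lam -> C_solution T lam t0 z0 z -> restrict T t0 t ->
  Cnorm z0 <= Cnorm (z t).
Proof.
  intros Hclosed Hstart Hlam [<- Hz] Ht; apply sqrt_le_1_alt.
  enough (fst (z t0) * fst (z t0) + snd (z t0) * snd (z t0) <=
          fst (z t) * fst (z t) + snd (z t) * snd (z t)) by lra.
  apply (delta_deriv_ge0_le (restrict T t0) t0
           (fun t => fst (z t) * fst (z t) + snd (z t) * snd (z t)));
    [now apply restrict_closed_from| |exact Ht]; clear t Ht; intros t Ht.
  destruct (Hz t Ht) as [Hre Him]; destruct (forward_jump_exists (restrict T t0) t) as [s Hs].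
  pose proof (delta_deriv_jump _ _ t s _ Ht Hs Hre) as Hzs_re; cbv beta in Hzs_re.
  pose proof (delta_deriv_jump _ _ t s _ Ht Hs Him) as Hzs_im; cbv beta in Hzs_im.
  pose proof (delta_deriv_mult _ _ _ t s _ _ Ht Hs Hre Hre) as Hre_sq.
  pose proof (delta_deriv_mult _ _ _ t s _ _ Ht Hs Him Him) as Him_sq.
  eexists; split; [|exact (delta_deriv_plus _ _ _ t _ _ Hre_sq Him_sq)].
  cbv beta; rewrite Hzs_re, Hzs_im; apply forward_jump_ge in Hs.
  set (D := fst (Cmul lam (z t))); set (D' := snd (Cmul lam (z t))).
  assert (Hinner : 0 <= fst (z t) * D + snd (z t) * D').
  { replace (_ + _) with (fst lam * (fst (z t) ^ 2 + snd (z t) ^ 2))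
      by (unfold D, D', Cmul; simpl; ring).
    apply Rmult_le_pos; [exact Hlam|apply Rplus_le_le_0_compat; apply pow2_ge_0]. }
  assert (0 <= (s - t) * (D ^ 2 + D' ^ 2)).
  { apply Rmult_le_pos; [lra|apply Rplus_le_le_0_compat; apply pow2_ge_0]. }
  lra.
Qed.

Lemma exp_decay_below (T : R -> Prop) (t0 al B c : R) :
  unbounded_above T -> 0 < al -> 0 < c -> 0 <= B ->
  exists t, restrict T t0 t /\ B * exp (- (al * (t - t0))) < c.
Proof.
  intros Hunb Hal Hc HB; assert (Hac : 0 < al * c) by now apply Rmult_lt_0_compat.
  destruct (restrict_unbounded T t0 (t0 + B / (al * c)) Hunb) as [t [Ht Hlt]].
  exists t; split; trivial; set (u := al * (t - t0)).
  assert (HBu : B < c * u).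
  { unfold u; replace B with (al * c * (B / (al * c))) by (field; lra).
    replace (c * (al * (t - t0))) with (al * c * (t - t0)) by ring; apply Rmult_lt_compat_l; lra. }
  pose proof (exp_ineq1_le u); pose proof (exp_pos (- u)) as Hpos.
  assert (Hinv : exp u * exp (- u) = 1) by (rewrite <- exp_plus, Rplus_opp_r; apply exp_0).
  rewrite <- (Rmult_1_r c), <- Hinv, <- Rmult_assoc; apply Rmult_lt_compat_r; nra.
Qed.

Theorem in_S_Re_neg (T : R -> Prop) (lam : C) :
  is_time_scale T -> unbounded_above T -> in_S T lam -> fst lam < 0.
Proof.
  intros [[t0 Hstart] Hclosed] Hunb (K & al & V & HK & Hal & HV & HVzero & Hstable).
  apply Rnot_le_lt; intros Hlam; destruct (HV C0 HVzero) as [r [Hr Hball]].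
  set (z0 := RtoC (r / 2)).
  assert (Hz0 : Cnorm z0 = r / 2) by (unfold z0; rewrite Cnorm_RtoC, Rabs_pos_eq; lra).
  destruct (C_solution_exists T lam t0 z0 Hclosed Hstart) as [z Hz].
  destruct (exp_decay_below T t0 al (K * (r / 2)) (r / 2)) as [t [Ht Hlt]]; trivial; [lra|nra|].
  pose proof (C_solution_Cnorm_ge T lam t0 t z0 z Hclosed Hstart Hlam Hz Ht) as Hgrow.
  assert (Hdecay : Cnorm (z t) <= K * exp (- (al * (t - t0))) * Cnorm z0).
  { destruct Ht as [Ht Hle]; apply (Hstable t0 t z0 z); trivial; apply Hball.
    unfold C0; simpl; rewrite !Rminus_0_r; change (Cnorm z0 < r); lra. }
  rewrite Hz0 in Hgrow, Hdecay; lra.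
Qed.

(** * Linear algebra over real closed fields *)

Module LinearAlgebra.
Import all_boot all_order all_algebra Rstruct complex polyrcf zify ring.
Import Order.TTheory GRing.Theory Num.Theory.
Local Open Scope ring_scope.
Local Delimit Scope R_scope with coqR.
Set Implicit Arguments.
Unset Strict Implicit.
Unset Printing Implicit Defensive.

Section HurwitzPolynomials.

Variable F : rcfType.
Implicit Types (p q : {poly F}) (z : F[i]).

Definition positive_coefs p := forall i, (i < size p)%N -> 0 < p`_i.

Lemma positive_coefs_ge0 p i : positive_coefs p -> 0 <= p`_i.
Proof.
move=> pos_p; have [ltip|leip] := ltnP i (size p); first exact/ltW/pos_p.
by rewrite nth_default.
Qed.

Lemma positive_coefsM p q : positive_coefs p -> positive_coefs q -> positive_coefs (p * q).
Proof.
move=> pos_p pos_q i.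
have [->|p0] := eqVneq p 0; first by rewrite mul0r size_poly0.
have [->|q0] := eqVneq q 0; first by rewrite mulr0 size_poly0.
have [sp sq] : (0 < size p)%N /\ (0 < size q)%N by rewrite !size_poly_gt0.
rewrite size_mul // -ltnS prednK ?addn_gt0 ?sp // => lti.
have ltj : (minn i (size p).-1 < i.+1)%N by rewrite ltnS geq_minl.
rewrite coefM (bigD1 (Ordinal ltj)) //=; apply: ltr_pwDl.
  by apply: mulr_gt0; [apply: pos_p | apply: pos_q]; move: sp sq lti;
    move: (size p) (size q) => a c; lia.
by apply: sumr_ge0 => k _; apply: mulr_ge0; exact: positive_coefs_ge0.
Qed.

Definition conj_quadratic z : {poly F} :=
  'X^2 - (complex.Re z *+ 2) *: 'X + (complex.Re z ^+ 2 + complex.Im z ^+ 2)%:P.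

Lemma map_conj_quadratic z :
  map_poly (real_complex F) (conj_quadratic z) = ('X - z%:P) * ('X - (z^*)%C%:P).
Proof.
have -> : ('X - z%:P) * ('X - (z^*)%C%:P) = 'X^2 - (z + (z^*)%C) *: 'X + (z * (z^*)%C)%:P.
  by rewrite -mul_polyC polyCD polyCM; ring.
rewrite rmorphD rmorphB /= map_polyXn map_polyZ /= map_polyX map_polyC /=.
case: z => x y /=.
congr (_ - _ *: _ + _%:P); apply/eqP; rewrite eq_complex /=.
  by rewrite mulr2n subrr !eqxx.
by apply/andP; split; apply/eqP; ring.
Qed.

Lemma conj_quadratic_monic z : conj_quadratic z \is monic.
Proof.
by rewrite -(map_monic (real_complex F)) map_conj_quadratic monicMl monicXsubC.
Qed.

Lemma size_conj_quadratic z : size (conj_quadratic z) = 3%N.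
Proof.
by rewrite -(size_map_poly (real_complex F)) map_conj_quadratic size_monicM ?monicXsubC
  ?polyXsubC_eq0 // !size_XsubC.
Qed.

Lemma positive_coefs_conj_quadratic z :
  complex.Re z < 0 -> complex.Im z != 0 -> positive_coefs (conj_quadratic z).
Proof.
move=> rez imz [|[|[|i]]]; rewrite size_conj_quadratic // !coefE /=.
- by rewrite !mulr0 subr0 add0r ltr_wpDl ?sqr_ge0 // lt_def sqr_ge0 expf_neq0.
- by rewrite mulr1 sub0r addr0 oppr_gt0 pmulrn_llt0.
- by rewrite mulr0 subr0 addr0 ltr01.
Qed.

Lemma positive_coefs_XsubC (x : F) : x < 0 -> positive_coefs ('X - x%:P).
Proof.
move=> x0 [|[|i]]; rewrite size_XsubC // !coefE /= ?subr0 ?ltr01 //.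
by rewrite sub0r oppr_gt0.
Qed.

Lemma conj_quadratic_dvdp p z :
  root (map_poly (real_complex F) p) z -> complex.Im z != 0 -> conj_quadratic z %| p.
Proof.
move=> rz imz; rewrite -(dvdp_map (real_complex F)) map_conj_quadratic.
rewrite Gauss_dvdp ?dvdp_XsubCl ?rz /=.
  rewrite -complex_root_conj (_ : map_poly _ _ = map_poly (real_complex F) p) //.
  by apply/polyP => i; rewrite !coef_map /= oppr0.
rewrite coprimep_XsubC root_XsubC; case: z imz {rz} => x y /=.
by rewrite eq_complex /= eqxx eqNr.
Qed.

Lemma hurwitz_factor p :
  size p != 1%N -> (forall z, root (map_poly (real_complex F) p) z -> complex.Re z < 0) ->
  exists r, [/\ r \is monic, (1 < size r)%N, positive_coefs r & r %| p].
Proof.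
move=> sp rootp.
have /closed_rootP [z rz] : size (map_poly (real_complex F) p) != 1%N by rewrite size_map_poly.
have rez := rootp z rz; have [imz|imz] := eqVneq (complex.Im z) 0.
  exists ('X - (complex.Re z)%:P); rewrite monicXsubC size_XsubC; split=> //.
    exact: positive_coefs_XsubC.
  have zE : z = (complex.Re z)%:C%C by apply/eqP; rewrite eq_complex /= imz !eqxx.
  by rewrite dvdp_XsubCl /root -(fmorph_eq0 (real_complex F)) -horner_map /= -zE.
exists (conj_quadratic z); rewrite conj_quadratic_monic size_conj_quadratic; split=> //.
  exact: positive_coefs_conj_quadratic.
exact: conj_quadratic_dvdp.
Qed.

Theorem hurwitz_positive_coefs p :
  0 < lead_coef p -> (forall z, root (map_poly (real_complex F) p) z -> complex.Re z < 0) ->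
  positive_coefs p.
Proof.
move: {2}(size p) (leqnn (size p)) => s; elim: s p => [|s IHs] p.
  by rewrite leqn0 size_poly_eq0 => /eqP->; rewrite lead_coef0 ltxx.
move=> sizep lcp rootp; have p0 : p != 0 by rewrite -lead_coef_eq0 gt_eqF.
have [size1|size_neq1] := eqVneq (size p) 1%N.
  by move=> i; rewrite size1 ltnS leqn0 => /eqP ->; move: lcp; rewrite lead_coefE size1.
have [r [monr sr posr /dvdpP [q pE]]] := hurwitz_factor size_neq1 rootp.
have q0 : q != 0 by apply: contraNneq p0 => q0; rewrite pE q0 mul0r.
rewrite pE; apply: positive_coefsM => //; apply: IHs.
- move: sizep sr; rewrite pE size_Mmonic //; move: (size q) (size r) => a c; lia.
- by move: lcp; rewrite pE lead_coefM (monicP monr) mulr1.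
- by move=> z rz; apply: rootp; rewrite pE rmorphM rootM rz.
Qed.

Lemma hurwitz_monic_coefs k (c : nat -> F) :
  (forall z, z ^+ k + \sum_(i < k) (c i)%:C%C * z ^+ i = 0 -> complex.Re z < 0) ->
  forall m, (m < k)%N -> 0 < c m.
Proof.
move=> stable m ltmk; pose p : {poly F} := 'X^k + \poly_(i < k) c i.
have sp : size p = k.+1 by rewrite size_polyDl size_polyXn // ltnS size_poly.
have pos_p : positive_coefs p.
  apply: hurwitz_positive_coefs => [|z].
    by rewrite lead_coefE sp /= !coefE eqxx ltnn addr0 ltr01.
  rewrite /root rmorphD /= map_polyXn hornerD hornerXn => /eqP root_z; apply: stable.
  rewrite -[RHS]root_z (@horner_coef_wide _ k) ?size_map_poly ?size_poly //; congr (_ + _).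
  by apply: eq_bigr => i _; rewrite coef_map coef_poly ltn_ord.
by have := pos_p m; rewrite sp ltnS (ltnW ltmk) !coefE ltmk (ltn_eqF ltmk) add0r => ->.
Qed.

End HurwitzPolynomials.

Lemma exists_last_root (F : rcfType) (q : {poly F}) c B :
  q != 0 -> root q c -> c < B ->
  exists m, [/\ c <= m, m < B, root q m & forall x, m < x < B -> ~~ root q x].
Proof.
move=> q0 rc cB; case: (prev_rootP q c B) => [/eqP|m _ /eqP qm mI noroot|_ _ _ noroot].
- by rewrite (negPf q0).
- by move: mI; rewrite in_itv /= => /andP[cm mB]; exists m; split=> //; exact: ltW.
- by exists c; split.
Qed.

(* At the last zero of the family before [B] all members are nonnegative, hence positive. *)
Lemma poly_family_positive (F : rcfType) (I : finType) (p : I -> {poly F}) (B : F) :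
  (forall s i, B <= s -> 0 < (p i).[s]) ->
  (forall s, 0 <= s -> (forall i, 0 <= (p i).[s]) -> forall i, 0 < (p i).[s]) ->
  forall s i, 0 <= s -> 0 < (p i).[s].
Proof.
move=> large step s i s0; rewrite ltNge; apply/negP => pis.
have sB : s < B by rewrite ltNge; apply: contraTN pis => /(large s i); rewrite ltNge.
pose q := \prod_i p i.
have rootq x : root q x = [exists i, root (p i) x].
  rewrite /root horner_prod.
  by apply/prodf_eq0/existsP => [[j _ pj]|[j pj]]; exists j.
have qB : ~~ root q B by rewrite rootq negb_exists; apply/forallP => j; rewrite /root gt_eqF ?large.
have q0 : q != 0 by apply: contraNneq qB => ->; rewrite root0.
have /(poly_ivt (ltW sB)) [c /andP[sc leqcB] rc] : (p i).[s] <= 0 <= (p i).[B].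
  by rewrite pis ltW ?large.
have rqc : root q c by rewrite rootq; apply/existsP; exists i.
have cB : c < B by rewrite lt_neqAle leqcB andbT; apply: contraNneq qB => <-.
have [m [cm mB rm noroot]] := exists_last_root q0 rqc cB.
have m0 : 0 <= m by rewrite (le_trans s0) // (le_trans sc).
have pm_gt0 : forall j, 0 < (p j).[m].
  apply: step => // j; rewrite leNgt; apply/negP => pjm.
  have /(poly_ivtoo (ltW mB)) [x xI rx] : (p j).[m] * (p j).[B] < 0 by rewrite nmulr_rlt0 ?large.
  have /negP[] : ~~ root q x by exact: noroot.
  by rewrite rootq; apply/existsP; exists j.
by move: rm; rewrite rootq => /existsP[j]; rewrite /root gt_eqF.
Qed.

Section MetzlerMatrices.

Variables (F : rcfType) (n : nat) (M : 'M[F]_n).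
Hypothesis metzlerM : forall i j, i != j -> 0 <= M i j.

Lemma row_mul_resolventE (s : F) (y : 'rV_n) k :
  (y *m (s%:M - M)) 0 k = s * y 0 k - \sum_i y 0 i * M i k.
Proof. by rewrite mulmxBr mul_mx_scalar !mxE. Qed.

(* A smallest entry of [y] cannot be negative. *)
Lemma metzler_resolvent_ge0 (s : F) (y : 'rV_n) :
  (forall k, \sum_i M i k < s) -> (forall k, 0 <= (y *m (s%:M - M)) 0 k) -> forall k, 0 <= y 0 k.
Proof.
move=> lt_s yR k; rewrite leNgt; apply/negP => yk.
have [j _ minj] := @Order.TotalTheory.arg_minP _ _ _ k xpredT (fun i => y 0 i) isT.
have yj : y 0 j < 0 by exact: le_lt_trans (minj k isT) yk.
have : (y *m (s%:M - M)) 0 j < 0.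
  rewrite row_mul_resolventE subr_lt0 (@lt_le_trans _ _ (y 0 j * \sum_i M i j)) //.
    by rewrite mulrC ltr_nM2l.
  rewrite mulr_sumr ler_sum // => i _; have [->//|ij] := eqVneq i j.
  by rewrite ler_wpM2r ?metzlerM // minj.
by rewrite ltNge yR.
Qed.

Lemma metzler_resolvent_gt0 (s : F) (y : 'rV_n) :
  (forall k, 0 <= y 0 k) -> (forall k, 0 < (y *m (s%:M - M)) 0 k) -> forall k, 0 < y 0 k.
Proof.
move=> y0 yR k; rewrite lt_def y0 andbT; apply/eqP => yk.
have := yR k; rewrite row_mul_resolventE yk mulr0 sub0r oppr_gt0 ltNge sumr_ge0 // => i _.
by have [->|ik] := eqVneq i k; rewrite ?yk ?mul0r // mulr_ge0 ?metzlerM.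
Qed.

Definition resolvent_poly : 'rV[{poly F}]_n :=
  char_poly M *: (const_mx 1 *m \adj (char_poly_mx M)).

Definition resolvent_row (s : F) : 'rV[F]_n := map_mx (horner_eval s) resolvent_poly.

Lemma resolvent_rowE (s : F) :
  resolvent_row s *m (s%:M - M) = (char_poly M).[s] ^+ 2 *: const_mx 1.
Proof.
have charE : s%:M - M = map_mx (horner_eval s) (char_poly_mx M).
  by apply/matrixP => i j; rewrite !mxE /horner_eval !hornerE; case: (i == j); rewrite /= !hornerE.
rewrite charE -map_mxM -scalemxAl -mulmxA mul_adj_mx mul_mx_scalar scalerA -expr2.
by apply/rowP => k; rewrite !mxE !mulr1 rmorphXn.
Qed.

Theorem metzler_left_certificate_mx :
  (forall s, 0 <= s -> ~~ eigenvalue M s) ->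
  exists w : 'rV_n, (forall i, 0 < w 0 i) /\ forall k, (w *m M) 0 k < 0.
Proof.
move=> noeig.
have res_gt0 s k : 0 <= s -> 0 < (resolvent_row s *m (s%:M - M)) 0 k.
  move=> s0; rewrite resolvent_rowE !mxE mulr1 lt_def sqr_ge0 expf_neq0 //.
  by rewrite -/(root _ _) -eigenvalue_root_char noeig.
have entryE s k : resolvent_row s 0 k = (resolvent_poly 0 k).[s] by rewrite mxE.
have pos : forall s i, 0 <= s -> 0 < (resolvent_poly 0 i).[s].
  apply: (@poly_family_positive _ _ _ (1 + \sum_k `|\sum_i M i k|)) => [s k leBs|s s0 ge0 k].
    have s0 : 0 <= s by apply: le_trans leBs; rewrite addr_ge0 ?sumr_ge0.
    have lt_s j : \sum_i M i j < s.
      rewrite (le_lt_trans (ler_norm _)) // (lt_le_trans _ leBs) // ltr_pwDl ?ltr01 //.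
      by rewrite [leRHS](bigD1 j) //= lerDl sumr_ge0.
    rewrite -entryE; apply: (@metzler_resolvent_gt0 s) => j; last exact: res_gt0.
    by apply: (@metzler_resolvent_ge0 s) => // i; rewrite ltW ?res_gt0.
  rewrite -entryE; apply: (@metzler_resolvent_gt0 s) => j; last exact: res_gt0.
  by rewrite mxE ge0.
exists (resolvent_row 0); split=> k; first by rewrite mxE pos.
have := res_gt0 0 k (lexx 0).
by rewrite raddf0 add0r mulmxN mxE oppr_gt0.
Qed.

End MetzlerMatrices.

Lemma eigenvalue_tr (F : fieldType) n (A : 'M[F]_n) lam : eigenvalue A^T lam = eigenvalue A lam.
Proof.
rewrite !eigenvalue_root_char /char_poly -det_tr; congr (root (\det _) lam).
by rewrite /char_poly_mx linearB /= tr_scalar_mx map_trmx trmxK.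
Qed.

Lemma eigenvalue_colP (F : fieldType) n (A : 'M[F]_n) lam :
  reflect (exists2 y : 'cV_n, A *m y = lam *: y & y != 0) (eigenvalue A lam).
Proof.
rewrite -eigenvalue_tr; apply: (iffP eigenvalueP) => -[y yA y0]; exists y^T; rewrite ?trmx_eq0 //.
  by rewrite -[A]trmxK -trmx_mul yA linearZ.
by rewrite -trmx_mul yA linearZ.
Qed.

(* The recursion of the vectors [v_m]; [A^k b = - a_1 b - ... ] is encoded as [v 0 = 0]. *)
Definition controller_chain (F : fieldType) n (A : 'M[F]_n) (b : 'cV_n) k (a : nat -> F)
    (v : nat -> 'cV_n) :=
  [/\ v k = b, v 0%N = 0 & forall m, (m < k)%N -> v m = A *m v m.+1 + a m.+1 *: b].

Lemma map_controller_chain (F G : fieldType) (f : {rmorphism F -> G}) n (A : 'M_n) b k a v :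
  controller_chain A b k a v ->
  controller_chain (map_mx f A) (map_mx f b) k (f \o a) (fun m => map_mx f (v m)).
Proof.
case=> vk v0 vS; split=> [||m ltmk]; rewrite ?vk ?v0 ?map_mx0 //.
by rewrite vS // map_mxD map_mxM map_mxZ.
Qed.

Section ControllerChain.

Variables (F : fieldType) (n : nat) (A : 'M[F]_n) (b : 'cV[F]_n) (K : 'rV[F]_n).
Variables (k : nat) (a : nat -> F) (v : nat -> 'cV[F]_n).
Hypothesis chain_v : controller_chain A b k a v.

Let c m := a m.+1 - (K *m v m.+1) 0 0.
Let M := A + b *m K.

Lemma closed_loop_chain m : (m < k)%N -> M *m v m.+1 = v m - c m *: b.
Proof.
move=> ltmk; have [_ _ vS] := chain_v.
rewrite (vS m ltmk) mulmxDl -mulmxA [K *m _]mx11_scalar mul_mx_scalar scalerBl opprB.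
by rewrite [_ *: b - _]addrC addrA addrK.
Qed.

Lemma closed_loop_chain_eigenvector z :
  z ^+ k + \sum_(m < k) c m * z ^+ m = 0 ->
  M *m (\sum_(m < k) z ^+ m *: v m.+1) = z *: \sum_(m < k) z ^+ m *: v m.+1.
Proof.
have [vk v0 _] := chain_v => root_z.
transitivity (\sum_(m < k.+1) z ^+ m *: v m).
  rewrite big_ord_recr /= vk mulmx_sumr.
  rewrite (eq_bigr (fun m : 'I_k => z ^+ m *: v m - (c m * z ^+ m) *: b)) => [|m _].
    by rewrite sumrB -scaler_suml -(addr0_eq root_z) scaleNr opprK.
  by rewrite -scalemxAr closed_loop_chain // scalerBr scalerA [z ^+ m * _]mulrC.
rewrite big_ord_recl v0 scaler0 add0r scaler_sumr.
by apply: eq_bigr => m _; rewrite scalerA exprS.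
Qed.

Lemma closed_loop_chain_left (u : 'rV_n) lam m :
  u *m M = lam *: u -> (m < k)%N ->
  (u *m v m) 0 0 = lam * (u *m v m.+1) 0 0 + c m * (u *m b) 0 0.
Proof.
move=> uM ltmk; have vE : v m = M *m v m.+1 + c m *: b by rewrite closed_loop_chain // subrK.
by rewrite vE mulmxDr mulmxA uM -scalemxAl -scalemxAr !mxE.
Qed.

Lemma krylov_sub_chain j : (((iter j (mulmx A) b)^T) <= \matrix_(m < k) (v m.+1)^T)%MS.
Proof.
set V := \matrix_m _; have [vk v0 vS] := chain_v.
have vV m : (m <= k)%N -> ((v m)^T <= V)%MS.
  case: m => [|m] ltmk; first by rewrite v0 trmx0 sub0mx.
  by rewrite (_ : _^T = row (Ordinal ltmk) V) ?row_sub // rowK.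
have bV : (b^T <= V)%MS by rewrite -vk vV.
elim: j => [//|j IHj] /=; rewrite trmx_mul (submx_trans (submxMr _ IHj)) //.
apply/row_subP => m; rewrite row_mul rowK -trmx_mul.
have -> : A *m v m.+1 = v m - a m.+1 *: b by rewrite (vS m) // addrK.
by rewrite linearB linearZ /= addmx_sub ?eqmx_opp ?scalemx_sub ?vV // ltnW.
Qed.

End ControllerChain.

(* Going down the chain from [v k = b] multiplies the pairing with [u] by positive factors. *)
Lemma closed_loop_nonneg_left_eigenvector (F : realFieldType) n (A : 'M[F]_n) b K k a v lam
    (u : 'rV_n) :
  controller_chain A b k a v -> (forall m, (m < k)%N -> (K *m v m.+1) 0 0 < a m.+1) ->
  0 <= lam -> u *m (A + b *m K) = lam *: u -> u *m b = 0.
Proof.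
move=> chain_v lt_a lam0 uM; have [vk v0 _] := chain_v.
set be := (u *m b) 0 0.
have pos d : (d <= k)%N -> exists2 p, 0 < p & (u *m v (k - d)%N) 0 0 = p * be.
  elim: d => [|d IHd] ltdk; first by exists 1; rewrite ?ltr01 // subn0 vk mul1r.
  have [p p0 pE] := IHd (ltnW ltdk); have ltmk : (k - d.+1 < k)%N by lia.
  exists (lam * p + (a (k - d.+1).+1 - (K *m v (k - d.+1).+1) 0 0)).
    by rewrite ltr_wpDl ?subr_gt0 ?lt_a // mulr_ge0 // ltW.
  by rewrite (closed_loop_chain_left chain_v uM ltmk) subnSK // pE mulrA [RHS]mulrDl.
have [p p0] := pos k (leqnn k); rewrite subnn v0 mulmx0 mxE => /esym/eqP.
by rewrite mulf_eq0 (gt_eqF p0) => /eqP be0; rewrite [u *m b]mx11_scalar -/be be0 raddf0.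
Qed.

(** * Transfer to matrices and vectors indexed by natural numbers *)

Definition mx_of n (M : nat -> nat -> R) : 'M[R]_n := \matrix_(i, j) M i j.
Definition col_of n (x : nat -> R) : 'cV[R]_n := \col_i x i.
Definition row_of n (x : nat -> R) : 'rV[R]_n := \row_i x i.

Definition nat_fun (T : nmodType) n (f : 'I_n -> T) (i : nat) : T :=
  if insub i is Some o then f o else 0.

Lemma nat_funE (T : nmodType) n (f : 'I_n -> T) (o : 'I_n) : nat_fun f o = f o.
Proof. by rewrite /nat_fun valK. Qed.

Lemma rsumE m (f : nat -> R) : rsum m f = \sum_(i < m) f i.
Proof. by elim: m => [|m IH]; rewrite ?big_ord0 ?big_ord_recr //= IH. Qed.

Lemma rsum_listE (l : seq nat) (f : nat -> R) : rsum_list l f = \sum_(j <- l) f j.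
Proof. by elim: l => [|j l IH]; rewrite ?big_nil ?big_cons //= IH. Qed.

Lemma mx_of_mul_col n M x : mx_of n M *m col_of n x = col_of n (mv n M x).
Proof. by apply/colP => i; rewrite !mxE /mv rsumE; apply: eq_bigr => j _; rewrite !mxE. Qed.

Lemma mx_of_closed_loop n A b K :
  mx_of n (closed_loop A b K) = mx_of n A + col_of n b *m row_of n K.
Proof. by apply/matrixP => i j; rewrite !mxE big_ord1 !mxE. Qed.

Lemma row_of_mul_col n K x : (row_of n K *m col_of n x) 0 0 = rsum n (fun j => (K j * x j)%coqR).
Proof. by rewrite !mxE rsumE; apply: eq_bigr => j _; rewrite !mxE. Qed.

Definition toC (z : C) : R[i] := Complex (fst z) (snd z).
Definition ofC (z : R[i]) : C := (complex.Re z, complex.Im z).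

Lemma ofCK : cancel ofC toC. Proof. by case. Qed.
Lemma toCK : cancel toC ofC. Proof. by case. Qed.

Lemma toC_eq0 (z : C) : toC z = 0 -> z = C0.
Proof. by move=> /(congr1 ofC); rewrite toCK. Qed.

Lemma toCM (z w : C) : toC (Cmul z w) = toC z * toC w.
Proof. by case: z w => x y [x' y']. Qed.

Lemma toCD (z w : C) : toC (Cadd z w) = toC z + toC w.
Proof. by case: z w => x y [x' y']. Qed.

Lemma toC_RtoCN (x : R) : toC (RtoC (Ropp x)) = - (x%:C)%C.
Proof. by rewrite -rmorphN. Qed.

Lemma toC_sum (l : seq nat) (f : nat -> C) : toC (Csum_list l f) = \sum_(j <- l) toC (f j).
Proof. by elim: l => [|j l IH]; rewrite ?big_nil ?big_cons //= toCD IH. Qed.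

Lemma toC_sum_seq n (f : nat -> C) : toC (Csum_list (List.seq 0 n) f) = \sum_(j < n) toC (f j).
Proof.
have -> : List.seq 0 n = index_iota 0 n.
  by rewrite /index_iota subn0; elim: n 0%N => //= n IHn m; rewrite IHn.
by rewrite toC_sum big_mkord.
Qed.

Lemma InP (l : seq nat) j : reflect (List.In j l) (j \in l).
Proof.
apply: (iffP idP); elim: l => [|x l IH] //=.
  by rewrite inE => /orP[/eqP ->|/IH]; [left | right].
by case=> [->|/IH jl]; rewrite inE ?eqxx // jl orbT.
Qed.

Lemma NoDup_uniq (l : seq nat) : NoDup l <-> uniq l.
Proof.
split; first by elim=> //= x s /InP xs _ ->; rewrite andbT.
elim: l => [|x l IH] /=; first by move=> _; exact: NoDup_nil.
by case/andP=> /InP xl /IH; exact: NoDup_cons.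
Qed.

Lemma ltbE p q : Nat.ltb p q = (p < q)%N.
Proof.
by apply/idP/idP => [/PeanoNat.Nat.ltb_lt/ssrnat.ltP|/ssrnat.ltP/PeanoNat.Nat.ltb_lt].
Qed.

Lemma eqbE p q : Nat.eqb p q = (p == q)%N.
Proof. by apply/idP/eqP => [/PeanoNat.Nat.eqb_eq|/PeanoNat.Nat.eqb_eq]. Qed.

Notation complex_mx := (map_mx (real_complex R)).

Lemma in_specP n M lam : in_spec n M lam <-> eigenvalue (complex_mx (mx_of n M)) (toC lam).
Proof.
split=> [[v [[i [/ssrnat.ltP lti vi]] Hv]]|/eigenvalue_colP[y yM y0]].
  apply/eigenvalue_colP; exists (\col_j toC (v j)).
    apply/colP => j; rewrite !mxE; have /(congr1 toC) := Hv j (ssrnat.ltP (ltn_ord j)).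
    by rewrite toC_sum_seq toCM => <-; apply: eq_bigr => l _; rewrite !mxE toCM.
  apply/eqP => /colP/(_ (Ordinal lti)); rewrite !mxE => /toC_eq0; exact: vi.
exists (fun i => ofC (nat_fun (fun o => y o 0) i)); split.
  have /cV0Pn[o yo] := y0; exists o; split; first exact/ssrnat.ltP.
  by rewrite nat_funE => /(congr1 toC); rewrite ofCK; apply/eqP.
move=> i /ssrnat.ltP lti; rewrite -[LHS]toCK toC_sum_seq -[RHS]toCK toCM ofCK; congr ofC.
have /colP/(_ (Ordinal lti)) := yM; rewrite !mxE (nat_funE _ (Ordinal lti)) => <-.
by apply: eq_bigr => j _; rewrite !mxE toCM ofCK nat_funE.
Qed.

Lemma in_spec_real n M lam : in_spec n M (RtoC lam) <-> eigenvalue (mx_of n M) lam.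
Proof. by rewrite in_specP -(eigenvalue_map (real_complex R)). Qed.

Theorem metzler_left_certificate n M :
  metzler n M -> (forall lam, (0 <= lam)%coqR -> ~ in_spec n M (RtoC lam)) ->
  exists w, left_certificate n M w.
Proof.
move=> metzlerM noeig; have [|lam lam0|w [w0 wM]] := @metzler_left_certificate_mx _ _ (mx_of n M).
- move=> i j ij; rewrite mxE; apply/RleP/metzlerM; try exact/ssrnat.ltP.
  by move=> eqij; case/eqP: ij; exact: ord_inj.
- by apply/negP => /in_spec_real; apply: noeig; exact/RleP.
exists (nat_fun (fun o => w 0 o)); split=> [i /ssrnat.ltP lti|j /ssrnat.ltP ltj]; apply/RltP.
  by rewrite (nat_funE _ (Ordinal lti)).
have := wM (Ordinal ltj); rewrite !mxE rsumE; congr (_ < _).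
by apply: eq_bigr => i _; rewrite nat_funE !mxE.
Qed.

Definition cols_mx (F : Type) m (M : nat -> nat -> F) (l : seq nat) : 'M[F]_(size l, m) :=
  \matrix_(p, i) M i (nth 0%N l p).

Lemma cols_mx_free (F : fieldType) m (M : nat -> nat -> F) (l : seq nat) :
  uniq l ->
  (forall c : nat -> F, (forall i, (i < m)%N -> \sum_(j <- l) c j * M i j = 0) ->
     forall j, j \in l -> c j = 0) ->
  row_free (cols_mx m M l).
Proof.
move=> ul indep_l; apply/inj_row_free => u uM; apply/rowP => p; rewrite mxE.
pose c j := nat_fun (u 0) (index j l).
have cE (o : 'I_(size l)) : c (nth 0%N l o) = u 0 o by rewrite /c index_uniq // nat_funE.
rewrite -cE; apply: indep_l; last exact: mem_nth.
move=> i lti; rewrite (big_nth 0%N) big_mkord.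
move/rowP/(_ (Ordinal lti)): uM; rewrite !mxE => uM; rewrite -[RHS]uM.
by apply: eq_bigr => o _; rewrite cE mxE.
Qed.

Lemma indep_cols_R_free m c M l : indep_cols_R m c M l -> row_free (cols_mx m M l).
Proof.
case=> /NoDup_uniq ul [_ indep_l]; apply: cols_mx_free => // d Hd j /InP jl.
by apply: indep_l jl => i /ssrnat.ltP lti; rewrite rsum_listE; exact: Hd.
Qed.

Lemma indep_cols_C_free m c M l :
  indep_cols_C m c M l -> row_free (cols_mx m (fun i j => toC (M i j)) l).
Proof.
case=> /NoDup_uniq ul [_ indep_l]; apply: cols_mx_free => // d Hd j /InP jl.
suff dj : ofC (d j) = C0 by rewrite -[d j]ofCK dj.
apply: (indep_l (fun j => ofC (d j))) jl => i /ssrnat.ltP lti; apply: toC_eq0.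
rewrite toC_sum -[RHS](Hd i lti).
by apply: eq_bigr => p _; rewrite toCM ofCK.
Qed.

Lemma rank_C_row_free m c M :
  rank_C m c M m <-> row_free (\matrix_(i < m, j < c) toC (M i j)).
Proof.
set G := \matrix_(_, _) _; split=> [[[l [sl indep_l]] _]|Gfree].
  have /eqP rl := indep_cols_C_free indep_l.
  rewrite /row_free eqn_leq rank_leq_row /= -[X in (X <= _)%N]sl -[X in (X <= _)%N]rl.
  rewrite -(mxrank_tr G).
  apply: mxrankS; apply/row_subP => p.
  have /InP/indep_l.2.1/ssrnat.ltP ltc : nth 0%N l p \in l by exact: mem_nth.
  rewrite (_ : row p _ = row (Ordinal ltc) G^T) ?row_sub //.
  by apply/rowP => i; rewrite !mxE.
split; last first.
  move=> l /indep_cols_C_free/eqP rl; apply/ssrnat.leP; rewrite -[length l]/(size l) -rl.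
  exact: rank_leq_col.
have Gfull : row_full G^T by rewrite /row_full mxrank_tr.
pose f := fullrankfun Gfull.
exists [seq nat_of_ord (f i) | i <- enum 'I_m]; split.
  by rewrite -[length _]/(size _) size_map size_enum_ord.
have finj : injective f by exact: fullrankfun_inj.
split; [|split].
- by apply/NoDup_uniq; rewrite map_inj_uniq ?enum_uniq // => i i' /ord_inj/finj.
- by move=> j /InP/mapP [i _ ->]; exact/ssrnat.ltP.
move=> d Hd j /InP/mapP [o _ ->]; apply: toC_eq0.
suff /rowP/(_ o) : \row_i toC (d (f i)) = 0 by rewrite !mxE.
apply: (row_free_inj (fullrowsub_free Gfull)); rewrite mul0mx; apply/rowP => i; rewrite !mxE.
have /(congr1 toC) := Hd i (ssrnat.ltP (ltn_ord i)).
rewrite toC_sum big_map big_enum /= => E; rewrite -[RHS]/(toC C0) -E.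
by apply: eq_bigr => p _; rewrite !mxE toCM.
Qed.

Lemma mul_row_augm n A b lam (u : 'rV[R[i]]_n) :
  u *m \matrix_(i < n, j < n.+1) toC (augm n A b lam i j) = 0 <->
  u *m complex_mx (mx_of n A) = toC lam *: u /\ u *m complex_mx (col_of n b) = 0.
Proof.
set G := \matrix_(_, _) _.
have state (j : 'I_n) :
    (u *m G) 0 (lift ord_max j) = (toC lam *: u - u *m complex_mx (mx_of n A)) 0 j.
  rewrite -mul_mx_scalar -mulmxBr !mxE; apply: eq_bigr => i _; congr (_ * _).
  rewrite !mxE /augm lift_max ltbE ltn_ord eqbE (inj_eq val_inj).
  by case: eqP => _; rewrite ?toCD toC_RtoCN ?mulr0n ?sub0r.
have input : (u *m G) 0 ord_max = (u *m complex_mx (col_of n b)) 0 0.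
  by rewrite !mxE; apply: eq_bigr => i _; rewrite !mxE /augm ltbE ltnn.
split=> [uG|[uA ub]].
  split; last by apply/rowP => j; rewrite ord1 -input uG !mxE.
  apply/eqP; rewrite eq_sym -subr_eq0; apply/eqP/rowP => j.
  by rewrite -state uG !mxE.
apply/rowP => j; have [j' ->|->] := unliftP ord_max j.
  by rewrite state uA subrr !mxE.
by rewrite input ub !mxE.
Qed.

Theorem hautus_test n A b lam :
  rank_C n n.+1 (augm n A b lam) n <->
  (forall u : 'rV[R[i]]_n, u *m complex_mx (mx_of n A) = toC lam *: u ->
     u *m complex_mx (col_of n b) = 0 -> u = 0).
Proof.
rewrite rank_C_row_free; split=> [Gfree u uA ub|indep].
  by apply: (row_free_inj Gfree); rewrite mul0mx; apply/mul_row_augm.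
by apply: inj_row_free => u /mul_row_augm[]; exact: indep.
Qed.

Theorem uncontrollable_in_spec n A b K lam :
  ~ rank_C n n.+1 (augm n A b lam) n -> in_spec n (closed_loop A b K) lam.
Proof.
move=> nrank; apply: NNPP => nspec; apply/nrank/hautus_test => u uA ub; apply/eqP.
apply: contra_notT nspec => u0; apply/in_specP/eigenvalueP; exists u => //.
by rewrite mx_of_closed_loop map_mxD map_mxM mulmxDr mulmxA ub mul0mx addr0.
Qed.

Lemma col_of_Apow n A b j : col_of n (Apow n A j b) = iter j (mulmx (mx_of n A)) (col_of n b).
Proof. by elim: j => //= j <-; rewrite mx_of_mul_col. Qed.

Lemma col_of_vvec n A b a k m :
  let r := (k - m)%N in
  col_of n (vvec n A b a k m) =
  col_of n (Apow n A r b) + \sum_(l < r) a (k - l)%N *: col_of n (Apow n A (r.-1 - l) b).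
Proof.
move=> r; apply/colP => i; rewrite !mxE summxE /vvec rsumE; congr (_ + _).
by apply: eq_bigr => l _; rewrite !mxE -subn1.
Qed.

Lemma vvec_controller_chain n A b a k :
  (forall i, (i < n)%coq_nat ->
     Apow n A k b i = (- rsum k (fun l => a (S l) * Apow n A l b i))%coqR) ->
  controller_chain (mx_of n A) (col_of n b) k a (fun m => col_of n (vvec n A b a k m)).
Proof.
move=> HApow; split=> [||m ltmk]; rewrite col_of_vvec.
- by rewrite subnn big_ord0 addr0.
- rewrite subn0; apply/colP => i; rewrite !mxE HApow ?rsumE; last exact/ssrnat.ltP.
  apply/eqP; rewrite addrC subr_eq0 summxE (reindex_inj rev_ord_inj) /=; apply/eqP.
  apply: eq_bigr => l _; rewrite !mxE subKn //; congr (_ * Apow _ _ _ _ _).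
  by have := ltn_ord l; lia.
rewrite col_of_vvec -(subnSK ltmk) big_ord_recr /= subnn.
rewrite mulmxDr mx_of_mul_col -addrA; congr (_ + (_ + _)); last by congr (a _ *: _); lia.
rewrite mulmx_sumr; apply: eq_bigr => l _; rewrite -scalemxAr mx_of_mul_col.
rewrite -[mv _ _ _]/(Apow n A ((k - m.+1).-1 - l).+1 b); congr (_ *: col_of _ (Apow _ _ _ _)).
by have := ltn_ord l; lia.
Qed.

Section ClosedLoopSpectrum.

Variables (n k : nat) (A : nat -> nat -> R) (a b K : nat -> R).
Hypothesis Apow_rel : forall i, (i < n)%coq_nat ->
  Apow n A k b i = (- rsum k (fun l => a (S l) * Apow n A l b i))%coqR.

Let v m := col_of n (vvec n A b a k m).
Let chain_v : controller_chain (mx_of n A) (col_of n b) k a v := vvec_controller_chain Apow_rel.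

Lemma vvec_row_free :
  rank_R n n (fun i j => Apow n A j b i) k -> row_free (\matrix_(m < k) (v m.+1)^T).
Proof.
case=> -[l [sl indep_l]] _; have /eqP rl := indep_cols_R_free indep_l.
rewrite /row_free eqn_leq rank_leq_row /= -[X in (X <= _)%N]sl -[X in (X <= _)%N]rl.
apply: mxrankS; apply/row_subP => p.
rewrite (_ : row p _ = (iter (nth 0%N l p) (mulmx (mx_of n A)) (col_of n b))^T).
  exact: krylov_sub_chain chain_v _.
by rewrite -col_of_Apow; apply/rowP => i; rewrite !mxE.
Qed.

Lemma closed_loop_root_in_spec (z : R[i]) :
  (0 < k)%N -> rank_R n n (fun i j => Apow n A j b i) k ->
  z ^+ k + \sum_(i < k) (a i.+1 - (row_of n K *m v i.+1) 0 0)%:C%C * z ^+ i = 0 ->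
  in_spec n (closed_loop A b K) (ofC z).
Proof.
move=> k0 /vvec_row_free Vfree root_z; apply/in_specP; rewrite ofCK.
apply/eigenvalue_colP; exists (\sum_(i < k) z ^+ i *: complex_mx (v i.+1)).
  rewrite mx_of_closed_loop map_mxD map_mxM.
  apply: (closed_loop_chain_eigenvector (map_controller_chain (real_complex R) chain_v)).
  rewrite -[RHS]root_z; congr (_ + _); apply: eq_bigr => i _; congr (_ * _).
  by rewrite -map_mxM mxE -rmorphB.
apply/eqP => sum0.
have complex_Vfree : row_free (complex_mx (\matrix_(m < k) (v m.+1)^T)) by rewrite row_free_map.
have : \row_(i < k) z ^+ i = 0.
  apply: (row_free_inj complex_Vfree).
  rewrite mul0mx mulmx_sum_row -[RHS]trmx0 -sum0 linear_sum /=; apply: eq_bigr => i _.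
  by rewrite linearZ /= mxE -map_row rowK map_trmx.
by move/rowP/(_ (Ordinal k0)); rewrite !mxE expr0 => /eqP; rewrite oner_eq0.
Qed.

Theorem closed_loop_coefs_gt0 :
  rank_R n n (fun i j => Apow n A j b i) k ->
  (forall lam, in_spec n (closed_loop A b K) lam -> (fst lam < 0)%coqR) ->
  forall m, (1 <= m)%coq_nat /\ (m <= k)%coq_nat ->
    (rsum n (fun j => K j * vvec n A b a k m j) < a m)%coqR.
Proof.
move=> rank_k stable [|m] [/ssrnat.leP // _ /ssrnat.leP ltmk].
apply/RltP; rewrite -row_of_mul_col -subr_gt0.
apply: (@hurwitz_monic_coefs _ k (fun i => a i.+1 - (row_of n K *m v i.+1) 0 0)) => // z root_z.
apply/RltP/(stable (ofC z))/closed_loop_root_in_spec => //.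
exact: leq_ltn_trans ltmk.
Qed.

Theorem closed_loop_no_nonneg_eigenvalue lam :
  (in_spec n A (RtoC lam) -> rank_C n n.+1 (augm n A b (RtoC lam)) n) ->
  (forall m, (1 <= m)%coq_nat /\ (m <= k)%coq_nat ->
     (rsum n (fun j => K j * vvec n A b a k m j) < a m)%coqR) ->
  (0 <= lam)%coqR -> ~ in_spec n (closed_loop A b K) (RtoC lam).
Proof.
move=> hautus lt_a /RleP lam0 /in_spec_real/eigenvalueP[w wM /eqP]; apply.
rewrite mx_of_closed_loop in wM.
have wb : w *m col_of n b = 0.
  apply: (closed_loop_nonneg_left_eigenvector chain_v _ lam0 wM) => m ltmk.
  rewrite row_of_mul_col; apply/RltP/lt_a; split; exact/ssrnat.leP.
have wA : w *m mx_of n A = lam *: w by rewrite -wM mulmxDr mulmxA wb mul0mx addr0.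
have [->//|w0] := eqVneq w 0.
have /hautus_test indep : rank_C n n.+1 (augm n A b (RtoC lam)) n.
  by apply: hautus; apply/in_spec_real/eigenvalueP; exists w.
apply/eqP; rewrite -(map_mx_eq0 (real_complex R)); apply/eqP.
by apply: indep; rewrite -map_mxM ?wA ?wb ?map_mxZ ?map_mx0.
Qed.

End ClosedLoopSpectrum.

End LinearAlgebra.
Import LinearAlgebra.

Theorem mainTheorem6 (T : R -> Prop) (n : nat) (A : nat -> nat -> R) (b : nat -> R)
  (mub : R) (k : nat) (a : nat -> R) :
  is_time_scale T ->
  unbounded_above T ->
  is_lub (grain_set T) mub ->
  positive_ctrl T n A b ->
  rank_R n n (fun i j => Apow n A j b i) k ->
  (forall i, (i < n)%nat -> Apow n A k b i = - rsum k (fun l => a (S l) * Apow n A l b i)) ->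
  (pos_stabilizable T n A b <->
    ((forall lam, in_spec n A lam -> ~ in_S T lam -> rank_C n (S n) (augm n A b lam) n) /\
     (exists K : nat -> R,
        (forall j, (j < n)%nat -> ge_ext (K j) (alpha n A b mub j)) /\
        (forall m, (1 <= m <= k)%nat -> rsum n (fun j => K j * vvec n A b a k m j) < a m)))).
Proof.
  intros HT Hunb Hlub Hctrl Hrank Hrel; pose proof HT as [_ Hclosed]; split.
  - intros [K [Hpos HUES]]; change (pos_UES T n (closed_loop A b K)) in HUES.
    assert (Hspec : forall lam, in_spec n (closed_loop A b K) lam -> in_S T lam)
      by (intros lam; now apply in_spec_in_S).
    split; [|exists K; split].
    + intros lam _ HnS; apply NNPP; intros Hrank_lam.
      now apply HnS, Hspec, uncontrollable_in_spec.
    + now apply (ge_alpha_positive_auto T n A b K mub).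
    + apply closed_loop_coefs_gt0; trivial.
      intros lam Hlam; now apply (in_S_Re_neg T), Hspec.
  - intros [Hhautus [K [Halpha Hlt]]]; exists K.
    apply (ge_alpha_positive_auto T n A b K mub) in Halpha; trivial.
    split; [exact Halpha|].
    destruct (@metzler_left_certificate n (closed_loop A b K)) as [w Hw].
    + now apply (positive_auto_metzler T).
    + intros lam Hlam; apply (closed_loop_no_nonneg_eigenvalue Hrel); trivial.
      intros HlamA; apply Hhautus; trivial; intros HS.
      apply (in_S_Re_neg T) in HS; trivial; simpl in HS; lra.
    + now apply (pos_UES_of_left_certificate T n _ w).
Qed.
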